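(* Let $\mathcal{F}$ be a Frobenius category with the subcategory $\mathcal{P}$ of projective-injective objects. Then the following hold. (1) $\mathsf{Mor}^{\mathrm{e}}(\mathcal{F})$ is a Frobenius category, and $\underline{\mathsf{Mor}}^{\mathrm{e}}(\mathcal{F})$ is a triangulated category. (2) $\mathsf{Mor}^{\mathrm{m}}(\mathcal{F})$ is a Frobenius category, and $\underline{\mathsf{Mor}}^{\mathrm{m}}(\mathcal{F})$ is a triangulated category. (3) $\mathsf{Mor}^{\mathrm{e}}(\mathcal{F})$ is equivalent to $\mathsf{Mor}^{\mathrm{m}}(\mathcal{F})$ as a Frobenius category, and $\underline{\mathsf{Mor}}^{\mathrm{e}}(\mathcal{F})$ is triangle equivalent to $\underline{\mathsf{Mor}}^{\mathrm{m}}(\mathcal{F})$.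
   Context: A Frobenius category is an exact category (in the sense of Quillen) with enough projectives and enough injectives in which projective and injective objects coincide. $\mathsf{Mor}^{\mathrm{e}}(\mathcal{F})$ (resp. $\mathsf{Mor}^{\mathrm{m}}(\mathcal{F})$) is the category whose objects are the admissible epimorphisms (resp. admissible monomorphisms) $\alpha:X\to Y$ of $\mathcal{F}$ and whose morphisms from $\alpha:X\to Y$ to $\beta:X'\to Y'$ are pairs $(f,g)$ of morphisms $f:X\to X'$, $g:Y\to Y'$ with $g\alpha=\beta f$. The exact structure on $\mathsf{Mor}^{\mathrm{e}}(\mathcal{F})$ is the one whose exact sequences are the sequences $\alpha\to\beta\to\gamma$ that are exact in $\mathcal{F}$ on sources and on targets (the sequence of kernels is then exact in $\mathcal{F}$ as well); the exact structure on $\mathsf{Mor}^{\mathrm{m}}(\mathcal{F})$ is the one whose exact sequences are those that are exact in $\mathcal{F}$ on sources, on targets and on cokernels. $\mathsf{Proj}(\mathsf{Mor}^{\mathrm{e}}(\mathcal{F}))$ (resp. $\mathsf{Proj}(\mathsf{Mor}^{\mathrm{m}}(\mathcal{F}))$) is the full subcategory of objects $X\to Y$ with $X,Y\in\mathcal{P}$; these are the projective-injective objects. $\underline{\mathsf{Mor}}^{\mathrm{e}}(\mathcal{F})$ (resp. $\underline{\mathsf{Mor}}^{\mathrm{m}}(\mathcal{F})$) is the stable category of $\mathsf{Mor}^{\mathrm{e}}(\mathcal{F})$ (resp. $\mathsf{Mor}^{\mathrm{m}}(\mathcal{F})$), i.e. its quotient by the ideal of morphisms factoring through objects of $\mathsf{Proj}(\mathsf{Mor}^{\mathrm{e}}(\mathcal{F}))$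 (resp. $\mathsf{Proj}(\mathsf{Mor}^{\mathrm{m}}(\mathcal{F}))$). *)

(* Defs.v *)
From HB Require Import structures.
From mathcomp Require Import all_boot ssralg.
From mathcomp Require Import generic_quotient ring_quotient boolp.

Set Implicit Arguments.
Unset Strict Implicit.
Unset Printing Implicit Defensive.

Import GRing.Theory.
Local Open Scope ring_scope.
Local Open Scope quotient_scope.

Declare Scope cat_scope.
Delimit Scope cat_scope with cat.
Local Open Scope cat_scope.

(* Categories enriched in abelian groups; equality of morphisms is Leibniz
   equality. *)
Record preaddCat := PreaddCat {
  obj :> Type;
  hom : obj -> obj -> zmodType;
  idm : forall X, hom X X;
  mcomp : forall X Y Z, hom Y Z -> hom X Y -> hom X Z;
  mcompA : forall W X Y Z (h : hom Y Z) (g : hom X Y) (f : hom W X),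
    mcomp h (mcomp g f) = mcomp (mcomp h g) f;
  mcomp1m : forall X Y (f : hom X Y), mcomp (idm Y) f = f;
  mcompm1 : forall X Y (f : hom X Y), mcomp f (idm X) = f;
  mcompDl : forall X Y Z (g g' : hom Y Z) (f : hom X Y),
    mcomp (g + g') f = mcomp g f + mcomp g' f;
  mcompDr : forall X Y Z (g : hom Y Z) (f f' : hom X Y),
    mcomp g (f + f') = mcomp g f + mcomp g f'
}.

Arguments idm {p} X.

Notation "g \oc f" := (mcomp g f) (at level 40, left associativity) : cat_scope.

Lemma mcomp0m (C : preaddCat) (X Y Z : C) (f : hom X Y) :
  (0 : hom Y Z) \oc f = 0.
Proof. by apply: (addIr (0 \oc f)); rewrite -mcompDl !add0r. Qed.

Lemma mcompm0 (C : preaddCat) (X Y Z : C) (g : hom Y Z) :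
  g \oc (0 : hom X Y) = 0.
Proof. by apply: (addIr (g \oc 0)); rewrite -mcompDr !add0r. Qed.

Lemma mcompNl (C : preaddCat) (X Y Z : C) (g : hom Y Z) (f : hom X Y) :
  (- g) \oc f = - (g \oc f).
Proof. by apply: (addIr (g \oc f)); rewrite -mcompDl !addNr mcomp0m. Qed.

Lemma mcompNr (C : preaddCat) (X Y Z : C) (g : hom Y Z) (f : hom X Y) :
  g \oc (- f) = - (g \oc f).
Proof. by apply: (addIr (g \oc f)); rewrite -mcompDr !addNr mcompm0. Qed.

Lemma mcompBl (C : preaddCat) (X Y Z : C) (g g' : hom Y Z) (f : hom X Y) :
  (g - g') \oc f = g \oc f - g' \oc f.
Proof. by rewrite mcompDl mcompNl. Qed.

Lemma mcompBr (C : preaddCat) (X Y Z : C) (g : hom Y Z) (f f' : hom X Y) :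
  g \oc (f - f') = g \oc f - g \oc f'.
Proof. by rewrite mcompDr mcompNr. Qed.

Definition is_iso (C : preaddCat) (X Y : C) (f : hom X Y) : Prop :=
  exists g : hom Y X, g \oc f = idm X /\ f \oc g = idm Y.

Definition is_zero_obj (C : preaddCat) (Z : C) : Prop :=
  forall X : C, (forall f : hom X Z, f = 0) /\ (forall f : hom Z X, f = 0).

Definition is_biproduct (C : preaddCat) (X Y S : C)
    (i1 : hom X S) (i2 : hom Y S) (p1 : hom S X) (p2 : hom S Y) : Prop :=
  [/\ p1 \oc i1 = idm X, p2 \oc i2 = idm Y, p1 \oc i2 = 0, p2 \oc i1 = 0
    & i1 \oc p1 + i2 \oc p2 = idm S].

Definition additive_cat (C : preaddCat) : Prop :=
  (exists Z : C, is_zero_obj Z) /\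
  (forall X Y : C, exists (S : C) (i1 : hom X S) (i2 : hom Y S)
     (p1 : hom S X) (p2 : hom S Y), is_biproduct i1 i2 p1 p2).

Record functor (C D : preaddCat) := Functor {
  fobj :> C -> D;
  fmap : forall X Y : C, hom X Y -> hom (fobj X) (fobj Y);
  fmap_id : forall X : C, fmap (idm X) = idm (fobj X);
  fmap_comp : forall (X Y Z : C) (g : hom Y Z) (f : hom X Y),
    fmap (g \oc f) = fmap g \oc fmap f;
  fmap_add : forall (X Y : C) (f g : hom X Y), fmap (f + g) = fmap f + fmap g
}.

Arguments fmap {C D} F {X Y} _ : rename.

Definition functor_id (C : preaddCat) : functor C C :=
  @Functor C C id (fun _ _ f => f)
    (fun _ => erefl) (fun _ _ _ _ _ => erefl) (fun _ _ _ _ => erefl).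

Section FunctorComp.
Context (C D E : preaddCat) (G : functor D E) (F : functor C D).

Let map (X Y : C) (f : hom X Y) : hom (G (F X)) (G (F Y)) := fmap G (fmap F f).

Let map_id (X : C) : map (idm X) = idm (G (F X)).
Proof. by rewrite /map !fmap_id. Qed.

Let map_comp (X Y Z : C) (g : hom Y Z) (f : hom X Y) :
  map (g \oc f) = map g \oc map f.
Proof. by rewrite /map !fmap_comp. Qed.

Let map_add (X Y : C) (f g : hom X Y) : map (f + g) = map f + map g.
Proof. by rewrite /map !fmap_add. Qed.

Definition functor_comp : functor C E := Functor map_id map_comp map_add.

End FunctorComp.

Definition is_nat_iso (C D : preaddCat) (F G : functor C D)
    (eta : forall X : C, hom (F X) (G X)) : Prop :=
  (forall X, is_iso (eta X)) /\
  (forall (X Y : C) (f : hom X Y), eta Y \oc fmap F f = fmap G f \oc eta X).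

Definition nat_isomorphic (C D : preaddCat) (F G : functor C D) : Prop :=
  exists eta : (forall X : C, hom (F X) (G X)), is_nat_iso eta.

Definition quasi_inverse (C D : preaddCat)
    (F : functor C D) (G : functor D C) : Prop :=
  nat_isomorphic (functor_comp G F) (functor_id C) /\
  nat_isomorphic (functor_comp F G) (functor_id D).

Definition is_equivalence (C D : preaddCat) (F : functor C D) : Prop :=
  exists G : functor D C, quasi_inverse F G.

Definition is_kernel (C : preaddCat) (X Y Z : C)
    (i : hom X Y) (p : hom Y Z) : Prop :=
  p \oc i = 0 /\
  forall (T : C) (t : hom T Y), p \oc t = 0 -> exists! s : hom T X, i \oc s = t.

Definition is_cokernel (C : preaddCat) (X Y Z : C)
    (i : hom X Y) (p : hom Y Z) : Prop :=
  p \oc i = 0 /\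
  forall (T : C) (t : hom Y T), t \oc i = 0 -> exists! s : hom Z T, s \oc p = t.

(* The square  X --f--> Y
               |i       |g
               I --u--> W  *)
Definition is_pushout (C : preaddCat) (X Y I W : C)
    (f : hom X Y) (i : hom X I) (g : hom Y W) (u : hom I W) : Prop :=
  g \oc f = u \oc i /\
  forall (T : C) (s : hom Y T) (t : hom I T), s \oc f = t \oc i ->
    exists! w : hom W T, w \oc g = s /\ w \oc u = t.

(* The square  W --u--> I
               |g       |p
               Y --f--> X  *)
Definition is_pullback (C : preaddCat) (X Y I W : C)
    (f : hom Y X) (p : hom I X) (g : hom W Y) (u : hom W I) : Prop :=
  f \oc g = p \oc u /\
  forall (T : C) (s : hom T Y) (t : hom T I), f \oc s = p \oc t ->
    exists! w : hom T W, g \oc w = s /\ u \oc w = t.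

Definition confl_class (C : preaddCat) : Type :=
  forall X Y Z : C, hom X Y -> hom Y Z -> Prop.

Definition adm_mono (C : preaddCat) (E : confl_class C) (X Y : C)
    (i : hom X Y) : Prop := exists (Z : C) (p : hom Y Z), E X Y Z i p.

Definition adm_epi (C : preaddCat) (E : confl_class C) (Y Z : C)
    (p : hom Y Z) : Prop := exists (X : C) (i : hom X Y), E X Y Z i p.

(* Quillen's axioms, in the form given by Keller and Buehler. *)
Record is_exact (C : preaddCat) (E : confl_class C) : Prop := IsExact {
  exact_additive : additive_cat C;
  exact_kercoker : forall (X Y Z : C) (i : hom X Y) (p : hom Y Z),
    E X Y Z i p -> is_kernel i p /\ is_cokernel i p;
  exact_iso_closed : forall (X Y Z X' Y' Z' : C)
      (i : hom X Y) (p : hom Y Z) (i' : hom X' Y') (p' : hom Y' Z')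
      (a : hom X X') (b : hom Y Y') (c : hom Z Z'),
    E X Y Z i p -> is_iso a -> is_iso b -> is_iso c ->
    b \oc i = i' \oc a -> c \oc p = p' \oc b -> E X' Y' Z' i' p';
  exact_id_mono : forall X : C, adm_mono E (idm X);
  exact_id_epi : forall X : C, adm_epi E (idm X);
  exact_comp_mono : forall (X Y Z : C) (i : hom X Y) (j : hom Y Z),
    adm_mono E i -> adm_mono E j -> adm_mono E (j \oc i);
  exact_comp_epi : forall (X Y Z : C) (p : hom X Y) (q : hom Y Z),
    adm_epi E p -> adm_epi E q -> adm_epi E (q \oc p);
  exact_pushout : forall (X Y I : C) (i : hom X I) (f : hom X Y),
    adm_mono E i ->
    exists (W : C) (g : hom Y W) (u : hom I W),
      is_pushout f i g u /\ adm_mono E g;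
  exact_pullback : forall (X Y I : C) (p : hom I X) (f : hom Y X),
    adm_epi E p ->
    exists (W : C) (g : hom W Y) (u : hom W I),
      is_pullback f p g u /\ adm_epi E g
}.

Definition inj_obj (C : preaddCat) (E : confl_class C) (I : C) : Prop :=
  forall (X Y : C) (i : hom X Y) (f : hom X I), adm_mono E i ->
    exists g : hom Y I, g \oc i = f.

Definition proj_obj (C : preaddCat) (E : confl_class C) (P : C) : Prop :=
  forall (Y Z : C) (p : hom Y Z) (f : hom P Z), adm_epi E p ->
    exists g : hom P Y, p \oc g = f.

Definition projinj (C : preaddCat) (E : confl_class C) (X : C) : Prop :=
  proj_obj E X /\ inj_obj E X.

Record is_frobenius (C : preaddCat) (E : confl_class C) : Prop := IsFrobenius {
  frob_exact : is_exact E;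
  frob_enough_inj : forall X : C, exists (I S : C) (i : hom X I) (p : hom I S),
    E X I S i p /\ inj_obj E I;
  frob_enough_proj : forall X : C, exists (K P : C) (k : hom K P) (q : hom P X),
    E K P X k q /\ proj_obj E P;
  frob_projinj : forall X : C, proj_obj E X <-> inj_obj E X
}.

Record frobCat := FrobCat {
  fcat :> preaddCat;
  confl : confl_class fcat;
  frobP : is_frobenius confl
}.

Arguments confl {f X Y Z} _ _.

Definition frobenius_functor (A B : frobCat) (F : functor A B) : Prop :=
  (forall (X Y Z : A) (i : hom X Y) (p : hom Y Z),
     confl i p -> confl (fmap F i) (fmap F p)) /\
  (forall X : A, projinj (@confl A) X -> projinj (@confl B) (F X)).

Definition frobenius_equivalent (A B : frobCat) : Prop :=
  exists (F : functor A B) (G : functor B A),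
    [/\ quasi_inverse F G, frobenius_functor F & frobenius_functor G].

Record triangle (C : preaddCat) (S : functor C C) := Tri {
  tX : C; tY : C; tZ : C;
  tf : hom tX tY;
  tg : hom tY tZ;
  th : hom tZ (S tX)
}.

Arguments Tri {C S tX tY tZ} tf tg th.

Definition triangle_iso (C : preaddCat) (S : functor C C)
    (t t' : triangle S) : Prop :=
  exists (a : hom (tX t) (tX t')) (b : hom (tY t) (tY t'))
         (c : hom (tZ t) (tZ t')),
    [/\ is_iso a, is_iso b & is_iso c] /\
    [/\ b \oc tf t = tf t' \oc a, c \oc tg t = tg t' \oc b
      & fmap S a \oc th t = th t' \oc c].

Record pretriang := Pretriang {
  tcat :> preaddCat;
  shift : functor tcat tcat;
  dist : triangle shift -> Prop
}.

Arguments shift {p}.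

Record is_triangulated (T : pretriang) : Prop := IsTriangulated {
  tr_additive : additive_cat T;
  tr_shift : is_equivalence (@shift T);
  tr_iso : forall t t' : triangle (@shift T),
    triangle_iso t t' -> dist t -> dist t';
  tr_id : forall X Z : T, is_zero_obj Z ->
    dist (Tri (idm X) (0 : hom X Z) (0 : hom Z (shift X)));
  tr_cone : forall (X Y : T) (f : hom X Y),
    exists (Z : T) (g : hom Y Z) (h : hom Z (shift X)), dist (Tri f g h);
  tr_rotate : forall (X Y Z : T)
      (f : hom X Y) (g : hom Y Z) (h : hom Z (shift X)),
    dist (Tri f g h) <-> dist (Tri g h (- fmap shift f));
  tr_mor : forall (X Y Z X' Y' Z' : T)
      (f : hom X Y) (g : hom Y Z) (h : hom Z (shift X))
      (f' : hom X' Y') (g' : hom Y' Z') (h' : hom Z' (shift X'))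
      (a : hom X X') (b : hom Y Y'),
    dist (Tri f g h) -> dist (Tri f' g' h') -> b \oc f = f' \oc a ->
    exists c : hom Z Z', c \oc g = g' \oc b /\ fmap shift a \oc h = h' \oc c;
  tr_octahedron : forall (X Y Z X' Y' Z' : T)
      (f : hom X Y) (a : hom Y Z') (a' : hom Z' (shift X))
      (g : hom Y Z) (b : hom Z X') (b' : hom X' (shift Y))
      (c : hom Z Y') (c' : hom Y' (shift X)),
    dist (Tri f a a') -> dist (Tri g b b') -> dist (Tri (g \oc f) c c') ->
    exists (u : hom Z' Y') (v : hom Y' X'),
      dist (Tri u v (fmap shift a \oc b')) /\
      [/\ u \oc a = c \oc g, c' \oc u = a', v \oc c = b
        & b' \oc v = fmap shift f \oc c']
}.

Definition triangle_equivalent (T U : pretriang) : Prop :=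
  exists F : functor T U, is_equivalence F /\
  exists phi : (forall X : T, hom (F (shift X)) (shift (F X))),
    @is_nat_iso T U (functor_comp F shift) (functor_comp shift F) phi /\
    forall (X Y Z : T) (f : hom X Y) (g : hom Y Z) (h : hom Z (shift X)),
      dist (Tri f g h) ->
      dist (Tri (fmap F f) (fmap F g) (phi X \oc fmap F h)).

Definition factors_projinj (A : frobCat) (X Y : A) (f : hom X Y) : Prop :=
  exists (Q : A) (a : hom X Q) (b : hom Q Y),
    projinj (@confl A) Q /\ f = b \oc a.

Definition stable_null (A : frobCat) (X Y : A) : {pred hom X Y} :=
  [pred f | `[< factors_projinj f >]].

Lemma stable_nullP (A : frobCat) (X Y : A) (f : hom X Y) :
  reflect (factors_projinj f) (f \in @stable_null A X Y).
Proof. by rewrite inE; exact: asboolP. Qed.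

Lemma projinj_biproduct (A : frobCat) (X Y S : A)
    (i1 : hom X S) (i2 : hom Y S) (p1 : hom S X) (p2 : hom S Y) :
  is_biproduct i1 i2 p1 p2 ->
  projinj (@confl A) X -> projinj (@confl A) Y -> projinj (@confl A) S.
Proof.
move=> [_ _ _ _ e] [pX iX] [pY iY]; split.
- move=> U V q f hq.
  have [g1 e1] := pX _ _ q (f \oc i1) hq.
  have [g2 e2] := pY _ _ q (f \oc i2) hq.
  exists (g1 \oc p1 + g2 \oc p2).
  by rewrite mcompDr !mcompA e1 e2 -!mcompA -mcompDr e mcompm1.
- move=> U V j f hj.
  have [g1 e1] := iX _ _ j (p1 \oc f) hj.
  have [g2 e2] := iY _ _ j (p2 \oc f) hj.
  exists (i1 \oc g1 + i2 \oc g2).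
  by rewrite mcompDl -!mcompA e1 e2 !mcompA -mcompDl e mcomp1m.
Qed.

Lemma stable_null_zmod_closed (A : frobCat) (X Y : A) :
  zmod_closed (@stable_null A X Y).
Proof.
have [[[Z hZ] hB] _ _ _ _ _ _ _ _] := frob_exact (frobP A).
split.
  apply/stable_nullP; exists Z, 0, 0; split; last by rewrite mcompm0.
  split.
  - by move=> U V p f _; exists 0; rewrite mcompm0 (proj2 (hZ V) f).
  - by move=> U V i f _; exists 0; rewrite mcomp0m (proj1 (hZ U) f).
move=> f g /stable_nullP[Q [a [b [hQ ->]]]] /stable_nullP[Q' [a' [b' [hQ' ->]]]].
have [S [i1 [i2 [p1 [p2 hS]]]]] := hB Q Q'.
have hSpi := projinj_biproduct hS hQ hQ'.
apply/stable_nullP; exists S, (i1 \oc a + i2 \oc a'), (b \oc p1 - b' \oc p2).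
split=> //; case: hS => e1 e2 e3 e4 _.
rewrite mcompBl !mcompDr -!mcompA.
rewrite (mcompA p1 i1) (mcompA p1 i2) (mcompA p2 i1) (mcompA p2 i2).
by rewrite e1 e2 e3 e4 !mcomp0m !mcomp1m !mcompm0 addr0 add0r.
Qed.

HB.instance Definition _ (A : frobCat) (X Y : A) :=
  GRing.isZmodClosed.Build (hom X Y) (@stable_null A X Y)
    (stable_null_zmod_closed X Y).

Definition stable_hom (A : frobCat) (X Y : A) : zmodType :=
  Quotient.quot (@stable_null A X Y).

Definition stable_class (A : frobCat) (X Y : A) (f : hom X Y) :
  stable_hom X Y := \pi_(Quotient.quot (@stable_null A X Y)) f.

Definition stable_repr (A : frobCat) (X Y : A) (f : stable_hom X Y) :
  hom X Y := @repr _ (Quotient.quot (@stable_null A X Y)) f.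

Lemma stable_reprK (A : frobCat) (X Y : A) (f : stable_hom X Y) :
  stable_class (stable_repr f) = f.
Proof. exact: reprK. Qed.

Lemma stable_classP (A : frobCat) (X Y : A) (f g : hom X Y) :
  stable_class f = stable_class g <-> factors_projinj (f - g).
Proof.
split=> [e|h].
- by apply/stable_nullP; rewrite Quotient.idealrBE; apply/eqP.
- by apply/eqP; rewrite -Quotient.idealrBE; apply/stable_nullP.
Qed.

Lemma stable_repr_class (A : frobCat) (X Y : A) (f : hom X Y) :
  factors_projinj (stable_repr (stable_class f) - f).
Proof. by apply/stable_classP; rewrite stable_reprK. Qed.

Lemma stable_classD (A : frobCat) (X Y : A) (f g : hom X Y) :
  stable_class (f + g) = stable_class f + stable_class g.
Proof. exact: raddfD. Qed.

Definition stable_comp (A : frobCat) (X Y Z : A)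
    (g : stable_hom Y Z) (f : stable_hom X Y) : stable_hom X Z :=
  stable_class (stable_repr g \oc stable_repr f).

Lemma stable_compE (A : frobCat) (X Y Z : A) (g : hom Y Z) (f : hom X Y) :
  stable_comp (stable_class g) (stable_class f) = stable_class (g \oc f).
Proof.
set g' := stable_repr (stable_class g); set f' := stable_repr (stable_class f).
have [Q [a [b [hQ e]]]] : factors_projinj (g' - g) := stable_repr_class g.
have [R [c [d [hR e']]]] : factors_projinj (f' - f) := stable_repr_class f.
have -> : stable_comp (stable_class g) (stable_class f)
          = stable_class (g' \oc f') by [].
transitivity (stable_class (g \oc f')); apply/stable_classP.
- by exists Q, (a \oc f'), b; rewrite -mcompBl e mcompA.
- by exists R, c, (g \oc d); rewrite -mcompBr e' mcompA.
Qed.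

Lemma stable_compA (A : frobCat) (W X Y Z : A) (h : stable_hom Y Z)
    (g : stable_hom X Y) (f : stable_hom W X) :
  stable_comp h (stable_comp g f) = stable_comp (stable_comp h g) f.
Proof.
rewrite -[f]stable_reprK -[g]stable_reprK -[h]stable_reprK.
by rewrite !stable_compE mcompA.
Qed.

Lemma stable_comp1m (A : frobCat) (X Y : A) (f : stable_hom X Y) :
  stable_comp (stable_class (idm Y)) f = f.
Proof. by rewrite -[f]stable_reprK stable_compE mcomp1m. Qed.

Lemma stable_compm1 (A : frobCat) (X Y : A) (f : stable_hom X Y) :
  stable_comp f (stable_class (idm X)) = f.
Proof. by rewrite -[f]stable_reprK stable_compE mcompm1. Qed.

Lemma stable_compDl (A : frobCat) (X Y Z : A) (g g' : stable_hom Y Z)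
    (f : stable_hom X Y) :
  stable_comp (g + g') f = stable_comp g f + stable_comp g' f.
Proof.
rewrite -[f]stable_reprK -[g]stable_reprK -[g']stable_reprK.
by rewrite -stable_classD !stable_compE mcompDl stable_classD.
Qed.

Lemma stable_compDr (A : frobCat) (X Y Z : A) (g : stable_hom Y Z)
    (f f' : stable_hom X Y) :
  stable_comp g (f + f') = stable_comp g f + stable_comp g f'.
Proof.
rewrite -[f]stable_reprK -[g]stable_reprK -[f']stable_reprK.
by rewrite -stable_classD !stable_compE mcompDr stable_classD.
Qed.

Definition stable (A : frobCat) : preaddCat :=
  @PreaddCat A (@stable_hom A) (fun X => stable_class (idm X)) (@stable_comp A)
    (@stable_compA A) (@stable_comp1m A) (@stable_compm1 A)
    (@stable_compDl A) (@stable_compDr A).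

Definition stable_mor (A : frobCat) (X Y : A) (f : hom X Y) :
  @hom (stable A) X Y := stable_class f.

Record hull (A : frobCat) (X : A) := Hull {
  hullI : A;
  hullS : A;
  hulli : hom X hullI;
  hullp : hom hullI hullS;
  hull_confl : confl hulli hullp;
  hull_inj : inj_obj (@confl A) hullI
}.

Lemma hull_exists (A : frobCat) (X : A) : exists h : hull X, True.
Proof.
have [I [S [i [p [hc hi]]]]] := frob_enough_inj (frobP A) X.
by exists (Hull hc hi).
Qed.

Definition hull_of (A : frobCat) (X : A) : hull X :=
  projT1 (cid (hull_exists X)).

Definition hI (A : frobCat) (X : A) : A := hullI (hull_of X).
Definition hS (A : frobCat) (X : A) : A := hullS (hull_of X).
Definition hi (A : frobCat) (X : A) : hom X (hI X) := hulli (hull_of X).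
Definition hp (A : frobCat) (X : A) : hom (hI X) (hS X) := hullp (hull_of X).

Lemma hi_hp_confl (A : frobCat) (X : A) : confl (hi X) (hp X).
Proof. exact: hull_confl. Qed.

Lemma hI_inj (A : frobCat) (X : A) : inj_obj (@confl A) (hI X).
Proof. exact: hull_inj. Qed.

Definition shift_lift (A : frobCat) (X Y : A) (f : hom X Y)
    (h : hom (hS X) (hS Y)) : Prop :=
  exists g : hom (hI X) (hI Y),
    g \oc hi X = hi Y \oc f /\ h \oc hp X = hp Y \oc g.

Lemma hi_extend (A : frobCat) (X Q : A) (f : hom X Q) :
  inj_obj (@confl A) Q -> exists g : hom (hI X) Q, g \oc hi X = f.
Proof.
by move=> hQ; apply: hQ; exists (hS X), (hp X); exact: hi_hp_confl.
Qed.

Lemma hp_hi (A : frobCat) (X : A) : hp X \oc hi X = 0.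
Proof.
by have [[]] := exact_kercoker (frob_exact (frobP A)) (hi_hp_confl X).
Qed.

Lemma hp_extend (A : frobCat) (X T : A) (t : hom (hI X) T) :
  t \oc hi X = 0 -> exists! s : hom (hS X) T, s \oc hp X = t.
Proof.
have [_ [_ h]] :=
  exact_kercoker (frob_exact (frobP A)) (hi_hp_confl X).
exact: h.
Qed.

Lemma hp_cancel (A : frobCat) (X T : A) (s t : hom (hS X) T) :
  s \oc hp X = t \oc hp X -> s = t.
Proof.
move=> e; have h0 : (t \oc hp X) \oc hi X = 0 by rewrite -mcompA hp_hi mcompm0.
by have [w [_ hw]] := hp_extend h0; rewrite -(hw _ e) -(hw _ erefl).
Qed.

Lemma shift_lift_exists (A : frobCat) (X Y : A) (f : hom X Y) :
  exists h, shift_lift f h.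
Proof.
have [g eg] := hi_extend (hi Y \oc f) (@hI_inj A Y).
have h0 : (hp Y \oc g) \oc hi X = 0.
  by rewrite -mcompA eg mcompA hp_hi mcomp0m.
by have [h [eh _]] := hp_extend h0; exists h, g.
Qed.

Lemma shift_lift_null (A : frobCat) (X Y : A) (f : hom X Y) h :
  factors_projinj f -> shift_lift f h -> factors_projinj h.
Proof.
move=> [Q [a [b [[_ iQ] ->]]]] [g [eg eh]].
have [a' ea] := hi_extend a iQ.
have h0 : (g - hi Y \oc (b \oc a')) \oc hi X = 0.
  by rewrite mcompBl eg -!mcompA ea subrr.
have [k [ek _]] := hp_extend h0.
have iY := @hI_inj A Y.
exists (hI Y), k, (hp Y); split.
  by split=> //; apply/(frob_projinj (frobP A)).
apply: hp_cancel.
by rewrite -mcompA ek mcompBr eh mcompA hp_hi mcomp0m subr0.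
Qed.

Lemma shift_liftB (A : frobCat) (X Y : A) (f f' : hom X Y) h h' :
  shift_lift f h -> shift_lift f' h' -> shift_lift (f - f') (h - h').
Proof.
move=> [g [e1 e2]] [g' [e1' e2']]; exists (g - g').
by rewrite !mcompBl !mcompBr e1 e2 e1' e2'.
Qed.

Lemma shift_liftD (A : frobCat) (X Y : A) (f f' : hom X Y) h h' :
  shift_lift f h -> shift_lift f' h' -> shift_lift (f + f') (h + h').
Proof.
move=> [g [e1 e2]] [g' [e1' e2']]; exists (g + g').
by rewrite !mcompDl !mcompDr e1 e2 e1' e2'.
Qed.

Lemma shift_lift_comp (A : frobCat) (X Y Z : A) (f : hom X Y) (f' : hom Y Z)
    h h' :
  shift_lift f h -> shift_lift f' h' -> shift_lift (f' \oc f) (h' \oc h).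
Proof.
move=> [g [e1 e2]] [g' [e1' e2']]; exists (g' \oc g); split.
- by rewrite -mcompA e1 !mcompA e1'.
- by rewrite -mcompA e2 !mcompA e2'.
Qed.

Lemma shift_lift_id (A : frobCat) (X : A) : shift_lift (idm X) (idm (hS X)).
Proof. by exists (idm (hI X)); rewrite !mcomp1m !mcompm1. Qed.

Definition shift_mor (A : frobCat) (X Y : A) (f : hom X Y) :
  hom (hS X) (hS Y) := projT1 (cid (shift_lift_exists f)).

Lemma shift_morP (A : frobCat) (X Y : A) (f : hom X Y) :
  shift_lift f (shift_mor f).
Proof. exact: projT2 (cid (shift_lift_exists f)). Qed.

Definition stable_shift_map (A : frobCat) (X Y : A)
    (f : @hom (stable A) X Y) : @hom (stable A) (hS X) (hS Y) :=
  stable_mor (shift_mor (stable_repr f)).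

Lemma stable_shift_mapE (A : frobCat) (X Y : A) (f : hom X Y) h :
  shift_lift f h -> stable_shift_map (stable_mor f) = stable_mor h.
Proof.
move=> hf; apply/stable_classP.
apply: (shift_lift_null (stable_repr_class f)).
by apply: shift_liftB => //; exact: shift_morP.
Qed.

Lemma stable_shift_map_id (A : frobCat) (X : stable A) :
  stable_shift_map (idm X) = @idm (stable A) (hS X).
Proof. exact: stable_shift_mapE (shift_lift_id X). Qed.

Lemma stable_shift_map_comp (A : frobCat) (X Y Z : stable A)
    (g : hom Y Z) (f : hom X Y) :
  stable_shift_map (g \oc f) =
  (stable_shift_map g : @hom (stable A) (hS Y) (hS Z)) \oc stable_shift_map f.
Proof.
rewrite -[f]stable_reprK -[g]stable_reprK.
have hf := shift_morP (stable_repr f); have hg := shift_morP (stable_repr g).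
rewrite (stable_shift_mapE hf) (stable_shift_mapE hg).
rewrite /mcomp /= !stable_compE.
exact: stable_shift_mapE (shift_lift_comp hf hg).
Qed.

Lemma stable_shift_map_add (A : frobCat) (X Y : stable A) (f g : hom X Y) :
  stable_shift_map (f + g) =
  (stable_shift_map f : @hom (stable A) (hS X) (hS Y)) + stable_shift_map g.
Proof.
rewrite -[f]stable_reprK -[g]stable_reprK.
have hf := shift_morP (stable_repr f); have hg := shift_morP (stable_repr g).
rewrite (stable_shift_mapE hf) (stable_shift_mapE hg) -!stable_classD.
exact: stable_shift_mapE (shift_liftD hf hg).
Qed.

Definition stable_shift (A : frobCat) : functor (stable A) (stable A) :=
  @Functor (stable A) (stable A) (@hS A) (@stable_shift_map A)
    (@stable_shift_map_id A) (@stable_shift_map_comp A)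
    (@stable_shift_map_add A).

(* The standard triangle of [f : X -> Y] is given by the push-out [W] of the
   chosen conflation [X -> hI X -> hS X] along [f]. *)
Definition stable_standard (A : frobCat) (t : triangle (stable_shift A)) :
    Prop :=
  exists (X Y W : A) (f : hom X Y) (g : hom Y W) (u : hom (hI X) W)
         (h : hom W (hS X)),
    [/\ is_pushout f (hi X) g u, h \oc g = 0, h \oc u = hp X
      & t = @Tri (stable A) (stable_shift A) X Y W
              (stable_mor f) (stable_mor g) (stable_mor h)].

Definition stable_triang (A : frobCat) : pretriang :=
  @Pretriang (stable A) (stable_shift A)
    (fun t => exists2 t0, stable_standard t0 & triangle_iso t0 t).

Definition mor_class (C : preaddCat) : Type :=
  forall X Y : C, hom X Y -> Prop.

Record arrow (C : preaddCat) (W : mor_class C) := Arrow {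
  asrc : C;
  atgt : C;
  amap : hom asrc atgt;
  arrowP : W asrc atgt amap
}.

Definition square (C : preaddCat) (W : mor_class C) (a b : arrow W) :
    {pred (hom (asrc a) (asrc b) * hom (atgt a) (atgt b))%type} :=
  [pred u | u.2 \oc amap a == amap b \oc u.1].

Arguments square {C W} a b.

Lemma square_zmod_closed (C : preaddCat) (W : mor_class C) (a b : arrow W) :
  zmod_closed (square a b).
Proof.
split; first by rewrite inE /= mcomp0m mcompm0.
move=> u v; rewrite !inE /= => /eqP eu /eqP ev.
by rewrite mcompBl mcompBr eu ev.
Qed.

HB.instance Definition _ (C : preaddCat) (W : mor_class C) (a b : arrow W) :=
  GRing.isZmodClosed.Build _ (square a b) (@square_zmod_closed C W a b).

Record arrow_hom (C : preaddCat) (W : mor_class C) (a b : arrow W) := ArrowHom {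
  arrow_pair : hom (asrc a) (asrc b) * hom (atgt a) (atgt b);
  arrow_pairP : arrow_pair \in square a b
}.

HB.instance Definition _ (C : preaddCat) (W : mor_class C) (a b : arrow W) :=
  [isSub for @arrow_pair C W a b].
HB.instance Definition _ (C : preaddCat) (W : mor_class C) (a b : arrow W) :=
  [Choice of arrow_hom a b by <:].
HB.instance Definition _ (C : preaddCat) (W : mor_class C) (a b : arrow W) :=
  [SubChoice_isSubZmodule of arrow_hom a b by <:].

Section ArrowCat.
Context (C : preaddCat) (W : mor_class C).
Implicit Types a b c d : arrow W.

Lemma arrow_id_subproof a : (idm (asrc a), idm (atgt a)) \in square a a.
Proof. by rewrite inE /= mcomp1m mcompm1. Qed.

Definition arrow_id a : arrow_hom a a := ArrowHom (arrow_id_subproof a).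

Lemma arrow_comp_subproof a b c (v : arrow_hom b c) (u : arrow_hom a b) :
  ((arrow_pair v).1 \oc (arrow_pair u).1,
   (arrow_pair v).2 \oc (arrow_pair u).2) \in square a c.
Proof.
case: u v => [u hu] [v hv] /=; move: hu hv; rewrite !inE /= => /eqP eu /eqP ev.
by rewrite -mcompA eu !mcompA ev.
Qed.

Definition arrow_comp a b c (v : arrow_hom b c) (u : arrow_hom a b) :
  arrow_hom a c := ArrowHom (arrow_comp_subproof v u).

Lemma arrow_compA a b c d (w : arrow_hom c d) (v : arrow_hom b c)
    (u : arrow_hom a b) :
  arrow_comp w (arrow_comp v u) = arrow_comp (arrow_comp w v) u.
Proof. by apply: val_inj; rewrite /= !mcompA. Qed.

Lemma arrow_comp1m a b (u : arrow_hom a b) : arrow_comp (arrow_id b) u = u.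
Proof. by apply: val_inj; rewrite /= !mcomp1m -surjective_pairing. Qed.

Lemma arrow_compm1 a b (u : arrow_hom a b) : arrow_comp u (arrow_id a) = u.
Proof. by apply: val_inj; rewrite /= !mcompm1 -surjective_pairing. Qed.

Lemma arrow_compDl a b c (v v' : arrow_hom b c) (u : arrow_hom a b) :
  arrow_comp (v + v') u = arrow_comp v u + arrow_comp v' u.
Proof. by apply: val_inj; rewrite /= !mcompDl. Qed.

Lemma arrow_compDr a b c (v : arrow_hom b c) (u u' : arrow_hom a b) :
  arrow_comp v (u + u') = arrow_comp v u + arrow_comp v u'.
Proof. by apply: val_inj; rewrite /= !mcompDr. Qed.

Definition arrow_cat : preaddCat :=
  @PreaddCat (arrow W) (fun a b => arrow_hom a b) arrow_id arrow_comp
    arrow_compA arrow_comp1m arrow_compm1 arrow_compDl arrow_compDr.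

End ArrowCat.

Definition MorE (F : frobCat) : preaddCat := arrow_cat (adm_epi (@confl F)).
Definition MorM (F : frobCat) : preaddCat := arrow_cat (adm_mono (@confl F)).

Definition arrow_src (C : preaddCat) (W : mor_class C) (a b : arrow W)
  (u : arrow_hom a b) : hom (asrc a) (asrc b) := (arrow_pair u).1.
Definition arrow_tgt (C : preaddCat) (W : mor_class C) (a b : arrow W)
  (u : arrow_hom a b) : hom (atgt a) (atgt b) := (arrow_pair u).2.

Definition MorE_confl (F : frobCat) : confl_class (MorE F) :=
  fun a b c u v =>
    confl (arrow_src u) (arrow_src v) /\ confl (arrow_tgt u) (arrow_tgt v).

Definition MorM_confl (F : frobCat) : confl_class (MorM F) :=
  fun a b c u v =>
    [/\ confl (arrow_src u) (arrow_src v), confl (arrow_tgt u) (arrow_tgt v)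
      & exists (Ka Kb Kc : F) (qa : hom (atgt a) Ka) (qb : hom (atgt b) Kb)
          (qc : hom (atgt c) Kc) (ku : hom Ka Kb) (kv : hom Kb Kc),
          [/\ is_cokernel (amap a) qa, is_cokernel (amap b) qb
            & is_cokernel (amap c) qc] /\
          [/\ ku \oc qa = qb \oc arrow_tgt u, kv \oc qb = qc \oc arrow_tgt v
            & confl ku kv]].

Definition Proj_MorE (F : frobCat) (a : MorE F) : Prop :=
  projinj (@confl F) (asrc a) /\ projinj (@confl F) (atgt a).

Definition Proj_MorM (F : frobCat) (a : MorM F) : Prop :=
  projinj (@confl F) (asrc a) /\ projinj (@confl F) (atgt a).

(* Main.v *)
Require Import Defs.
From mathcomp Require Import all_boot ssralg.
From mathcomp Require Import boolp.

(* Mor^e(F) and Mor^m(F) are the categories of arrows in a class W that is closed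
   under extensions: this is the 3 x 3 lemma, which also makes exactness on
   cokernels automatic in Mor^m(F).  For every such W the componentwise
   conflations form an exact structure, all cokernels, push-outs and pull-backs
   being computed componentwise and lying in W as extensions of arrows of W.
   Enough projective-injectives come from the horseshoe lemma, and kernels and
   cokernels are mutually quasi-inverse Frobenius functors.  The stable category
   of an arbitrary Frobenius category is triangulated by Happel's argument, and
   a Frobenius functor with a Frobenius quasi-inverse descends to a triangle
   equivalence of stable categories. *)

Set Implicit Arguments.
Unset Strict Implicit.
Unset Printing Implicit Defensive.

Import GRing.Theory.
Local Open Scope ring_scope.
Local Open Scope cat_scope.

(** Duality is by conversion: reversing the homs of F exchanges kernels with cokernels and push-outs
    with pull-backs definitionally, so half of the lemmas on exact categories cost one line. In an
    arrow category a morphism into or out of a componentwise projective-injective object extends or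
    lifts on each component, but the two results need not commute with the arrows; the defect
    factors through a cokernel or a kernel, and is removed either by a splitting of the object or by
    the admissibility of the arrows. In the stable category the shift depends on a chosen injective
    hull of each object, whereas the octahedron and the image of a functor produce other conflations
    [X -> J -> S] with [J] injective; the comparison of such conflations, unique up to maps through
    an injective, makes triangles independent of the choice. Cones are compared without the five
    lemma: an endomorphism of a triangle that is the identity on the first two terms differs from
    the identity on the third by a map of square zero. *)

Lemma mcomp_eqr (C : preaddCat) (X Y Z T : C) (g : hom Y Z) (f : hom X Y) h :
  g \oc f = h -> forall x : hom Z T, x \oc g \oc f = x \oc h.
Proof. by move=> <- x; rewrite mcompA. Qed.

Lemma square_inv (C : preaddCat) (X Y X' Y' : C) (f : hom X Y) (f' : hom X' Y')
    (a : hom X X') (b : hom Y Y') (a' : hom X' X) (b' : hom Y' Y) :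
  b \oc f = f' \oc a -> a \oc a' = idm X' -> b' \oc b = idm Y ->
  f \oc a' = b' \oc f'.
Proof.
by move=> e ea eb; rewrite -[f' in RHS]mcompm1 -ea (mcompA f') -e !mcompA eb mcomp1m.
Qed.

(** * Isomorphisms, kernels, opposite categories and push-outs *)

Section Iso.
Context (C : preaddCat).
Implicit Types X Y Z : C.

Lemma is_iso_id X : is_iso (idm X).
Proof. by exists (idm X); rewrite mcomp1m. Qed.

Lemma is_iso_comp X Y Z (g : hom Y Z) (f : hom X Y) :
  is_iso g -> is_iso f -> is_iso (g \oc f).
Proof.
move=> [g' [g1 g2]] [f' [f1 f2]]; exists (f' \oc g').
by rewrite !mcompA (mcomp_eqr g1) mcompm1 f1 (mcomp_eqr f2) mcompm1.
Qed.

Definition monic X Y (f : hom X Y) :=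
  forall (T : C) (s t : hom T X), f \oc s = f \oc t -> s = t.
Definition epic X Y (f : hom X Y) :=
  forall (T : C) (s t : hom Y T), s \oc f = t \oc f -> s = t.

Lemma is_kernel_monic X Y Z (i : hom X Y) (p : hom Y Z) :
  is_kernel i p -> monic i.
Proof.
move=> [e h] T s t est.
have h0 : p \oc (i \oc t) = 0 by rewrite mcompA e mcomp0m.
by have [w [_ hw]] := h _ _ h0; rewrite -(hw _ est) (hw _ erefl).
Qed.

Lemma is_kernel_uniq X X' Y Z (i : hom X Y) (i' : hom X' Y) (p : hom Y Z) :
  is_kernel i p -> is_kernel i' p -> exists2 a, is_iso a & i' \oc a = i.
Proof.
move=> k k'; have [a [ea _]] := proj2 k' _ _ (proj1 k).
have [b [eb _]] := proj2 k _ _ (proj1 k').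
exists a => //; exists b; split.
- by apply: (is_kernel_monic k); rewrite mcompA eb ea mcompm1.
- by apply: (is_kernel_monic k'); rewrite mcompA ea eb mcompm1.
Qed.

End Iso.

Section Opposite.
Context (C : preaddCat).

(** Only the homs are reversed, so a kernel, a push-out or an admissible monomorphism in [opcat C]
    is by conversion a cokernel, a pull-back or an admissible epimorphism in [C]. Dual statements
    below are instances at [opcat C]. *)
Definition opcat : preaddCat :=
  @PreaddCat C (fun X Y => hom Y X) (fun X => idm X)
    (fun X Y Z g f => f \oc g)
    (fun W X Y Z h g f => esym (mcompA f g h))
    (fun X Y f => mcompm1 f) (fun X Y f => mcomp1m f)
    (fun X Y Z g g' f => mcompDr f g g') (fun X Y Z g f f' => mcompDl f f' g).

Definition opconfl (E : confl_class C) : confl_class opcat :=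
  fun X Y Z i p => E Z Y X p i.

Lemma is_iso_op (X Y : C) (f : hom X Y) :
  @is_iso opcat Y X f <-> is_iso f.
Proof. by split=> -[g [e1 e2]]; exists g. Qed.

Lemma is_biproduct_op (X Y S : C)
    (i1 : hom X S) (i2 : hom Y S) (p1 : hom S X) (p2 : hom S Y) :
  is_biproduct i1 i2 p1 p2 -> @is_biproduct opcat X Y S p1 p2 i1 i2.
Proof. by case=> *; split. Qed.

Lemma additive_op : additive_cat C -> additive_cat opcat.
Proof.
move=> [[Z hZ] hB]; split; first by exists Z => X; case: (hZ X).
move=> X Y; have [S [i1 [i2 [p1 [p2 h]]]]] := hB X Y.
by exists S, p1, p2, i1, i2; exact: is_biproduct_op.
Qed.

Lemma is_exact_op (E : confl_class C) : is_exact E -> is_exact (opconfl E).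
Proof.
case=> add kc ic idm_ ide cm ce po pb; split.
- exact: additive_op.
- by move=> X Y Z i p /kc[hk hc]; split.
- move=> X Y Z X' Y' Z' i p i' p' a b c h [a' [a1 a2]] [b' [b1 b2]] [c' [c1 c2]].
  move=> e1 e2.
  (* Reversing the homs also reverses the isomorphism of sequences, so the closure axiom is applied
     to the inverses. *)
  apply: (ic _ _ _ _ _ _ _ _ _ _ c' b' a' h).
  + by exists c.
  + by exists b.
  + by exists a.
  + exact: esym (@square_inv C _ _ _ _ _ _ c b c' b' (esym e2) c1 b2).
  + exact: esym (@square_inv C _ _ _ _ _ _ b a b' a' (esym e1) b1 a2).
- exact: ide.
- exact: idm_.
- by move=> X Y Z i j hi hj; exact: ce hj hi.
- by move=> X Y Z i j hi hj; exact: cm hj hi.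
- exact: pb.
- exact: po.
Qed.

End Opposite.

Lemma is_cokernel_epic (C : preaddCat) (X Y Z : C) (i : hom X Y) (p : hom Y Z) :
  is_cokernel i p -> epic p.
Proof. exact: (@is_kernel_monic (opcat C) Z Y X p i). Qed.

Lemma is_cokernel_uniq (C : preaddCat) (X Y Z Z' : C)
    (i : hom X Y) (p : hom Y Z) (p' : hom Y Z') :
  is_cokernel i p -> is_cokernel i p' -> exists2 c, is_iso c & c \oc p' = p.
Proof.
move=> k k'.
have [a /is_iso_op ha e] := @is_kernel_uniq (opcat C) _ _ _ _ p p' i k k'.
by exists a.
Qed.

Lemma is_pushout_epic (C : preaddCat) (X Y I W T : C)
    (f : hom X Y) (i : hom X I) (g : hom Y W) (u : hom I W) (s t : hom W T) :
  is_pushout f i g u -> s \oc g = t \oc g -> s \oc u = t \oc u -> s = t.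
Proof.
move=> [e h] e1 e2; have e0 : t \oc g \oc f = t \oc u \oc i by rewrite -!mcompA e.
by have [w [_ hw]] := h _ _ _ e0; rewrite -(hw s) // -(hw t).
Qed.

Lemma is_pushout_sym (C : preaddCat) (X Y I W : C)
    (f : hom X Y) (i : hom X I) (g : hom Y W) (u : hom I W) :
  is_pushout f i g u -> is_pushout i f u g.
Proof.
move=> [e h]; split=> // T s t est; have [w [[w1 w2] uw]] := h _ _ _ (esym est).
by exists w; split=> // w' [w1' w2']; apply: uw.
Qed.

Lemma is_pushout_paste (C : preaddCat) (X Y I W J V : C)
    (f : hom X Y) (i : hom X I) (g : hom Y W) (u : hom I W)
    (j : hom I J) (v : hom W V) (w : hom J V) :
  is_pushout f i g u -> is_pushout u j v w -> is_pushout f (j \oc i) (v \oc g) w.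
Proof.
move=> h1 h2; split; first by rewrite -mcompA (proj1 h1) !mcompA (proj1 h2).
move=> T s t; rewrite mcompA => /(proj2 h1)[x [[xg xu] _]].
have [y [[yv yw] _]] := proj2 h2 _ _ _ xu.
exists y; split; first by rewrite mcompA yv.
move=> y' [y1 y2]; apply: (is_pushout_epic h2); last by rewrite yw.
apply: (is_pushout_epic h1); first by rewrite yv xg -mcompA y1.
by rewrite yv xu -y2 -!mcompA (proj1 h2).
Qed.

Lemma is_pullback_monic (C : preaddCat) (X Y I W T : C)
    (f : hom Y X) (p : hom I X) (g : hom W Y) (u : hom W I) (s t : hom T W) :
  is_pullback f p g u -> g \oc s = g \oc t -> u \oc s = u \oc t -> s = t.
Proof. exact: (@is_pushout_epic (opcat C) X Y I W T f p g u s t). Qed.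

(** * Exact categories *)

Section Exact.
Context (C : preaddCat) (E : confl_class C) (hE : is_exact E).
Implicit Types X Y Z W : C.

Lemma confl_kernel X Y Z (i : hom X Y) (p : hom Y Z) :
  E i p -> is_kernel i p.
Proof. by case/(exact_kercoker hE). Qed.

Lemma confl_cokernel X Y Z (i : hom X Y) (p : hom Y Z) :
  E i p -> is_cokernel i p.
Proof. by case/(exact_kercoker hE). Qed.

Lemma confl0 X Y Z (i : hom X Y) (p : hom Y Z) : E i p -> p \oc i = 0.
Proof. by case/confl_kernel. Qed.

Lemma confl_monic X Y Z (i : hom X Y) (p : hom Y Z) : E i p -> monic i.
Proof. by move/confl_kernel; exact: is_kernel_monic. Qed.

Lemma confl_epic X Y Z (i : hom X Y) (p : hom Y Z) : E i p -> epic p.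
Proof. by move/confl_cokernel; exact: is_cokernel_epic. Qed.

Lemma confl_mono X Y Z (i : hom X Y) (p : hom Y Z) : E i p -> adm_mono E i.
Proof. by exists Z, p. Qed.

Lemma confl_epi X Y Z (i : hom X Y) (p : hom Y Z) : E i p -> adm_epi E p.
Proof. by exists X, i. Qed.

(** Admissibility supplies a conflation with some cokernel of [i]; any other cokernel is isomorphic
    to it, and conflations are closed under isomorphism. *)
Lemma cokernel_confl X Y Z (i : hom X Y) (p : hom Y Z) :
  adm_mono E i -> is_cokernel i p -> E i p.
Proof.
move=> [Z' [p' h]] hp.
have [c hc e] := is_cokernel_uniq hp (confl_cokernel h).
apply: (exact_iso_closed hE h (is_iso_id X) (is_iso_id Y) hc).
  by rewrite mcomp1m mcompm1.
by rewrite mcompm1.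
Qed.

Lemma adm_mono_iso X Y Y' (i : hom X Y) (b : hom Y Y') :
  adm_mono E i -> is_iso b -> adm_mono E (b \oc i).
Proof.
move=> [Z [p h]] hb; have [b' [b1 b2]] := hb; exists Z, (p \oc b').
apply: (exact_iso_closed hE h (is_iso_id X) hb (is_iso_id Z)).
  by rewrite mcompm1.
by rewrite (mcomp_eqr b1) mcomp1m mcompm1.
Qed.

(** The axiom provides one push-out with an admissible leg; a given push-out is isomorphic to that
    one. *)
Lemma pushout_adm_mono X Y I W
    (f : hom X Y) (i : hom X I) (g : hom Y W) (u : hom I W) :
  is_pushout f i g u -> adm_mono E i -> adm_mono E g.
Proof.
move=> h /(exact_pushout hE f)[W' [g' [u' [h' hg']]]].
have [w [[wg wu] _]] := proj2 h' _ _ _ (proj1 h).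
have [v [[vg vu] _]] := proj2 h _ _ _ (proj1 h').
rewrite -wg; apply: adm_mono_iso => //; exists v; split.
- by apply: (is_pushout_epic h'); rewrite -mcompA ?wg ?wu mcomp1m.
- by apply: (is_pushout_epic h); rewrite -mcompA ?vg ?vu mcomp1m.
Qed.

(** Push-out keeps the cokernel: a map out of [W] killing [g] is determined by its restriction to
    [I], and this restriction kills [i], so it factors through [p]. *)
Lemma pushout_confl X Y I S W (f : hom X Y) (i : hom X I) (p : hom I S)
    (g : hom Y W) (u : hom I W) (h : hom W S) :
  E i p -> is_pushout f i g u -> h \oc g = 0 -> h \oc u = p -> E g h.
Proof.
move=> hip hpo hg hu; apply: cokernel_confl.
  exact: pushout_adm_mono hpo (confl_mono hip).
split=> // T t tg.
have e0 : t \oc u \oc i = 0 by rewrite -mcompA -(proj1 hpo) mcompA tg mcomp0m.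
have [s [es _]] := proj2 (confl_cokernel hip) _ _ e0.
exists s; split.
  by apply: (is_pushout_epic hpo); rewrite -mcompA ?hg ?hu // mcompm0 tg.
by move=> s' es'; apply: (confl_epic hip); rewrite es -es' -mcompA hu.
Qed.

Lemma adm_mono_pushout X Y I S (f : hom X Y) (i : hom X I) (p : hom I S) :
  E i p -> exists (W : C) (g : hom Y W) (u : hom I W) (h : hom W S),
    [/\ is_pushout f i g u, E g h & h \oc u = p].
Proof.
move=> hip; have [W [g [u [hpo _]]]] := exact_pushout hE f (confl_mono hip).
have e0 : 0 \oc f = p \oc i by rewrite mcomp0m (confl0 hip).
have [h [[hg hu] _]] := proj2 hpo _ _ _ e0.
by exists W, g, u, h; split=> //; exact: pushout_confl hpo hg hu.
Qed.

End Exact.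

Section ExactDual.
Context (C : preaddCat) (E : confl_class C) (hE : is_exact E).
Implicit Types X Y Z W : C.

Lemma kernel_confl X Y Z (i : hom X Y) (p : hom Y Z) :
  adm_epi E p -> is_kernel i p -> E i p.
Proof. exact: (@cokernel_confl (opcat C) _ (is_exact_op hE) Z Y X p i). Qed.

Lemma pullback_adm_epi X Y I W
    (f : hom Y X) (p : hom I X) (g : hom W Y) (u : hom W I) :
  is_pullback f p g u -> adm_epi E p -> adm_epi E g.
Proof. exact: (@pushout_adm_mono (opcat C) _ (is_exact_op hE) X Y I W). Qed.

Lemma pullback_confl X Y I S W (f : hom Y X) (i : hom S I) (p : hom I X)
    (g : hom W Y) (u : hom W I) (h : hom S W) :
  E i p -> is_pullback f p g u -> g \oc h = 0 -> u \oc h = i -> E h g.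
Proof. exact: (@pushout_confl (opcat C) _ (is_exact_op hE) X Y I S W). Qed.

Lemma adm_epi_pullback X Y I S (f : hom Y X) (i : hom S I) (p : hom I X) :
  E i p -> exists (W : C) (g : hom W Y) (u : hom W I) (h : hom S W),
    [/\ is_pullback f p g u, E h g & u \oc h = i].
Proof. exact: (@adm_mono_pushout (opcat C) _ (is_exact_op hE) X Y I S). Qed.

(* With D = Y + I, the map (g, u) : D -> W is the pull-back of p along h, hence
   an admissible epimorphism; its kernel is (-f, i), so it is a cokernel. *)
Lemma confl_pushout X Y I S W (f : hom X Y) (i : hom X I) (p : hom I S)
    (g : hom Y W) (u : hom I W) (h : hom W S) :
  E i p -> E g h -> g \oc f = u \oc i -> h \oc u = p -> is_pushout f i g u.
Proof.
move=> hip hgh e hu.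
have [_ hB] := exact_additive hE.
have [D [i1 [i2 [p1 [p2 [e11 e22 e12 e21 e1]]]]]] := hB Y I.
set d := g \oc p1 + u \oc p2.
have d1 : d \oc i1 = g by rewrite mcompDl -!mcompA e11 e21 mcompm1 mcompm0 addr0.
have d2 : d \oc i2 = u by rewrite mcompDl -!mcompA e12 e22 mcompm1 mcompm0 add0r.
have hd : h \oc d = p \oc p2.
  by rewrite mcompDr !mcompA (confl0 hE hgh) hu mcomp0m add0r.
have jointD T (s t : hom T D) : p1 \oc s = p1 \oc t -> p2 \oc s = p2 \oc t -> s = t.
  by move=> a b; rewrite -[s]mcomp1m -[t]mcomp1m -e1 !mcompDl -!mcompA a b.
have hpb : is_pullback h p d p2.
  split=> // T s t est.
  have : h \oc (s - u \oc t) = 0 by rewrite mcompBr est mcompA hu subrr.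
  case/(proj2 (confl_kernel hE hgh)) => y [ey _].
  have q1 : p1 \oc (i1 \oc y + i2 \oc t) = y.
    by rewrite mcompDr !mcompA e11 e12 mcomp1m mcomp0m addr0.
  have q2 : p2 \oc (i1 \oc y + i2 \oc t) = t.
    by rewrite mcompDr !mcompA e21 e22 mcomp1m mcomp0m add0r.
  have q3 : d \oc (i1 \oc y + i2 \oc t) = s.
    by rewrite mcompDr !mcompA d1 d2 ey subrK.
  exists (i1 \oc y + i2 \oc t); split=> // w [w1 w2].
  apply: jointD; rewrite ?q1 ?q2 //.
  apply: (confl_monic hE hgh); rewrite ey -w1 -w2 !mcompA -mcompBl.
  by rewrite /d addrK.
have hde := pullback_adm_epi hpb (confl_epi hip).
set k := i2 \oc i - i1 \oc f.
have k1 : p1 \oc k = - f by rewrite mcompBr !mcompA e11 e12 mcomp1m mcomp0m sub0r.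
have k2 : p2 \oc k = i by rewrite mcompBr !mcompA e21 e22 mcomp1m mcomp0m subr0.
have hk : is_kernel k d.
  split; first by rewrite mcompBr !mcompA d1 d2 e subrr.
  move=> T t dt.
  have : p \oc (p2 \oc t) = 0 by rewrite mcompA -hd -mcompA dt mcompm0.
  case/(proj2 (confl_kernel hE hip)) => x [ex _].
  exists x; split.
    apply: jointD; rewrite mcompA ?k1 ?k2 //.
    apply: (confl_monic hE hgh); rewrite mcompNl mcompNr mcompA e -mcompA ex.
    apply/eqP; rewrite eq_sym -addr_eq0 !mcompA -mcompDl.
    exact/eqP.
  move=> x' ex'; apply: (confl_monic hE hip); rewrite ex -ex' mcompA k2 //.
have hcok := confl_cokernel hE (kernel_confl hde hk).
split=> // T s t est.
have : (s \oc p1 + t \oc p2) \oc k = 0.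
  by rewrite mcompDl -!mcompA k1 k2 mcompNr est addNr.
case/(proj2 hcok) => w [ew uw].
exists w; split.
  rewrite -{1}d1 -{1}d2 !mcompA ew !mcompDl -!mcompA e11 e12 e21 e22.
  by rewrite !mcompm0 !mcompm1 addr0 add0r.
by move=> w' [w1 w2]; apply: uw; rewrite mcompDr !mcompA w1 w2.
Qed.

(* k is the push-out of j along p. *)
Lemma confl_quotient (X Y Z P Q R : C) (i : hom X Y) (p : hom Y P)
    (j : hom Y Z) (q : hom Z Q) (r : hom Z R) (k : hom P R) (l : hom R Q) :
  E i p -> E j q -> E (j \oc i) r -> k \oc p = r \oc j -> l \oc r = q -> E k l.
Proof.
move=> hip hjq hr ek el.
have hpo : is_pushout p j k r.
  split=> // T s t est.
  have : t \oc (j \oc i) = 0 by rewrite mcompA -est -mcompA (confl0 hE hip) mcompm0.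
  case/(proj2 (confl_cokernel hE hr)) => w [ew uw]; exists w; split.
    split=> //; apply: (confl_epic hE hip).
    by rewrite -mcompA ek mcompA ew.
  by move=> w' [_ ew']; exact: uw.
apply: (pushout_confl hE hjq hpo) => //.
by apply: (confl_epic hE hip); rewrite -mcompA ek mcompA el (confl0 hE hjq) mcomp0m.
Qed.

(** The Noether isomorphism [(Z/X)/(Y/X) = Z/Y], with [P = Y/X], [R = Z/X] and [Q = Z/Y]. *)
Lemma confl_comp_mono (X Y Z P Q : C) (i : hom X Y) (p : hom Y P)
    (j : hom Y Z) (q : hom Z Q) :
  E i p -> E j q -> exists (R : C) (r : hom Z R) (k : hom P R) (l : hom R Q),
    [/\ E (j \oc i) r, E k l, k \oc p = r \oc j & l \oc r = q].
Proof.
move=> hip hjq.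
have [R [r hr]] := exact_comp_mono hE (confl_mono hip) (confl_mono hjq).
have : r \oc j \oc i = 0 by rewrite -mcompA (confl0 hE hr).
case/(proj2 (confl_cokernel hE hip)) => k [ek _].
have : q \oc (j \oc i) = 0 by rewrite mcompA (confl0 hE hjq) mcomp0m.
case/(proj2 (confl_cokernel hE hr)) => l [el _].
by exists R, r, k, l; split=> //; exact: confl_quotient hip hjq hr ek el.
Qed.

End ExactDual.

(** * The 3 x 3 lemma *)

Section ThreeByThree.
Context (C : preaddCat) (E : confl_class C) (hE : is_exact E).

Lemma confl_pullback (X Y I S W : C) (f : hom Y X) (i : hom S I) (p : hom I X)
    (g : hom W Y) (u : hom W I) (h : hom S W) :
  E i p -> E h g -> f \oc g = p \oc u -> u \oc h = i -> is_pullback f p g u.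
Proof. exact: (@confl_pushout (opcat C) _ (is_exact_op hE) X Y I S W). Qed.

Lemma confl_comp_epi (X Y Z K L : C) (i : hom K X) (p : hom X Y)
    (j : hom L Y) (q : hom Y Z) :
  E i p -> E j q -> exists (M : C) (m : hom M X) (k : hom K M) (l : hom M L),
    [/\ E m (q \oc p), E k l, m \oc k = i & j \oc l = p \oc m].
Proof.
move=> hip hjq.
have [M [m [l [k [h1 h2 h3 h4]]]]] :=
  @confl_comp_mono (opcat C) _ (is_exact_op hE) Z Y X L K q j p i hjq hip.
by exists M, m, k, l.
Qed.

Context (A1 A2 A3 B1 B2 B3 : C) (i : hom A1 A2) (p : hom A2 A3)
  (i' : hom B1 B2) (p' : hom B2 B3)
  (a1 : hom A1 B1) (a2 : hom A2 B2) (a3 : hom A3 B3).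
Context (hip : E i p) (hip' : E i' p')
  (e1 : a2 \oc i = i' \oc a1) (e2 : a3 \oc p = p' \oc a2).

(* a2 factors as A2 -> D -> B2, where D is the push-out of A1 -> B1 along i;
   D is also the pull-back of a3 along p'. *)
Lemma three_by_three_mono (C1 C3 : C) (c1 : hom B1 C1) (c3 : hom B3 C3) :
  E a1 c1 -> E a3 c3 ->
  adm_mono E a2 /\
  forall (C2 : C) (c2 : hom B2 C2) (k : hom C1 C2) (l : hom C2 C3),
    is_cokernel a2 c2 -> k \oc c1 = c2 \oc i' -> l \oc c2 = c3 \oc p' -> E k l.
Proof.
move=> h1 h3.
have [D [dB [dA [hD [hpo hDc ehD]]]]] := adm_mono_pushout hE a1 hip.
have : 0 \oc i = c1 \oc a1 by rewrite mcomp0m (confl0 hE h1).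
have hpo' := is_pushout_sym hpo.
case/(proj2 hpo') => cD [[cD1 cD2] _].
have hcD : E dA cD by apply: pushout_confl h1 hpo' cD1 cD2.
have [w [[w1 w2] _]] := proj2 hpo' _ _ _ e1.
have e3 : a3 \oc hD = p' \oc w.
  apply: (is_pushout_epic hpo); rewrite -!mcompA.
    by rewrite (confl0 hE hDc) w2 (confl0 hE hip') mcompm0.
  by rewrite ehD w1.
have hpb := confl_pullback hip' hDc e3 w2.
(* The map [w] is the base change along [p'] of [a3], the kernel of [c3]; hence it is the kernel of
   the admissible epimorphism [c3 p']. *)
have hw : E w (c3 \oc p').
  apply: (kernel_confl hE).
    exact: (exact_comp_epi hE (confl_epi hip') (confl_epi h3)).
  split; first by rewrite -mcompA -e3 mcompA (confl0 hE h3) mcomp0m.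
  move=> T t; rewrite -mcompA => /(proj2 (confl_kernel hE h3))[s [es _]].
  have [v [[v1 v2] uv]] := proj2 hpb _ _ _ es.
  exists v; split=> // v' ev'; apply: uv; split=> //.
  by apply: (confl_monic hE h3); rewrite es -ev' mcompA e3 mcompA.
have ha : adm_mono E (w \oc dA).
  by apply: (exact_comp_mono hE); [exists C1, cD | exists C3, (c3 \oc p')].
split; first by rewrite -w1.
move=> C2 c2 k l hc2 ek el.
have hc : E (w \oc dA) c2.
  by apply: (cokernel_confl hE); last by rewrite w1.
(* In the chain [A2 -> D -> B2] the successive quotients are [C1 = D/A2] and [C3 = B2/D], so
   [C2 = B2/A2] is an extension of [C3] by [C1]. *)
apply: (confl_quotient hE hcD hw hc _ el).
apply: (is_pushout_epic hpo); rewrite -!mcompA.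
  by rewrite cD2 w2.
by rewrite cD1 w1 (proj1 hc2) mcompm0.
Qed.

End ThreeByThree.

Section ThreeByThreeDual.
Context (C : preaddCat) (E : confl_class C) (hE : is_exact E).

Lemma three_by_three_epi (A1 A2 A3 B1 B2 B3 : C) (i : hom A1 A2) (p : hom A2 A3)
    (i' : hom B1 B2) (p' : hom B2 B3)
    (a1 : hom A1 B1) (a2 : hom A2 B2) (a3 : hom A3 B3)
    (K1 K3 : C) (k1 : hom K1 A1) (k3 : hom K3 A3) :
  E i p -> E i' p' -> a2 \oc i = i' \oc a1 -> a3 \oc p = p' \oc a2 ->
  E k1 a1 -> E k3 a3 ->
  adm_epi E a2 /\
  forall (K2 : C) (k2 : hom K2 A2) (k : hom K1 K2) (l : hom K2 K3),
    is_kernel k2 a2 -> i \oc k1 = k2 \oc k -> k3 \oc l = p \oc k2 -> E k l.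
Proof.
move=> h h' e1 e2 h1 h3.
have [H1 H2] := @three_by_three_mono (opcat C) _ (is_exact_op hE) _ _ _ _ _ _
   p' i' p i a3 a2 a1 h' h (esym e2) (esym e1) _ _ k3 k1 h3 h1.
by split=> // K2 k2 k l hk ek el; exact: (H2 K2 k2 l k hk).
Qed.

Lemma confl_id0 (X Z : C) : is_zero_obj Z -> E (idm X) (0 : hom X Z).
Proof.
move=> hZ; apply: cokernel_confl => //; first exact: exact_id_mono.
split; first by rewrite mcomp0m.
move=> T t; rewrite mcompm1 => ->; exists 0; split; first by rewrite mcomp0m.
by move=> s _; rewrite (proj2 (hZ T) s).
Qed.

Lemma confl_0id (X Z : C) : is_zero_obj Z -> E (0 : hom Z X) (idm X).
Proof.
move=> hZ; apply: kernel_confl => //; first exact: exact_id_epi.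
split; first by rewrite mcompm0.
move=> T t; rewrite mcomp1m => ->; exists 0; split; first by rewrite mcompm0.
by move=> s _; rewrite (proj1 (hZ T) s).
Qed.

(* X + Y -> Y is the pull-back of X -> 0 along Y -> 0. *)
Lemma biproduct_confl (X Y S : C)
    (i1 : hom X S) (i2 : hom Y S) (p1 : hom S X) (p2 : hom S Y) :
  is_biproduct i1 i2 p1 p2 -> E i1 p2.
Proof.
move=> [e11 e22 e12 e21 e].
have [[Z hZ] _] := exact_additive hE.
apply: (@pullback_confl _ _ hE Z Y X X S 0 (idm X) 0 p2 p1 i1) => //.
  exact: confl_id0.
split; first by rewrite !mcomp0m.
move=> T s t _; exists (i2 \oc s + i1 \oc t); split.
  by rewrite !mcompDr !mcompA e11 e22 e12 e21 !mcomp1m !mcomp0m addr0 add0r.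
by move=> w [<- <-]; rewrite !mcompA -mcompDl addrC e mcomp1m.
Qed.

End ThreeByThreeDual.

(** * Categories of arrows *)

Section ArrowCategory.
Context (C : preaddCat) (W : mor_class C).
Implicit Types a b c d : arrow_cat W.

Lemma arrow_square a b (u : hom a b) :
  arrow_tgt u \oc amap a = amap b \oc arrow_src u.
Proof. by case: u => u /= hu; exact/eqP. Qed.

Definition arrow_mk a b (f : hom (asrc a) (asrc b)) (g : hom (atgt a) (atgt b))
    (e : g \oc amap a = amap b \oc f) : @hom (arrow_cat W) a b :=
  @ArrowHom C W a b (f, g) (introT eqP e).

(** The existential hides the pair and its commutation proof, leaving two component equations to
    rewrite with. *)
Lemma arrow_mkK a b (f : hom (asrc a) (asrc b)) (g : hom (atgt a) (atgt b)) :
  g \oc amap a = amap b \oc f ->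
  exists2 u : hom a b, arrow_src u = f & arrow_tgt u = g.
Proof. by move=> e; exists (arrow_mk e). Qed.

Lemma arrow_ext a b (u v : hom a b) :
  arrow_src u = arrow_src v -> arrow_tgt u = arrow_tgt v -> u = v.
Proof.
case: u v => [[u1 u2] hu] [[v1 v2] hv]; rewrite /arrow_src /arrow_tgt /= => e1 e2.
by apply: val_inj; rewrite /= e1 e2.
Qed.

Lemma arrow_srcM a b c (v : hom b c) (u : hom a b) :
  arrow_src (v \oc u) = arrow_src v \oc arrow_src u.
Proof. by []. Qed.

Lemma arrow_tgtM a b c (v : hom b c) (u : hom a b) :
  arrow_tgt (v \oc u) = arrow_tgt v \oc arrow_tgt u.
Proof. by []. Qed.

Lemma arrow_src_eq a b c d (v : hom b c) (u : hom a b) (v' : hom d c)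
    (u' : hom a d) : v \oc u = v' \oc u' ->
  arrow_src v \oc arrow_src u = arrow_src v' \oc arrow_src u'.
Proof. by move=> e; rewrite -!arrow_srcM e. Qed.

Lemma arrow_tgt_eq a b c d (v : hom b c) (u : hom a b) (v' : hom d c)
    (u' : hom a d) : v \oc u = v' \oc u' ->
  arrow_tgt v \oc arrow_tgt u = arrow_tgt v' \oc arrow_tgt u'.
Proof. by move=> e; rewrite -!arrow_tgtM e. Qed.

Lemma arrow_iso a b (u : hom a b) :
  is_iso u <-> is_iso (arrow_src u) /\ is_iso (arrow_tgt u).
Proof.
split=> [[v [e1 e2]]|[[f [f1 f2]] [g [g1 g2]]]].
  split; [exists (arrow_src v)|exists (arrow_tgt v)];
  by rewrite -?arrow_srcM -?arrow_tgtM e1 e2.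
have [|v v1 v2] := @arrow_mkK b a f g.
  by rewrite (@square_inv _ _ _ _ _ _ _ _ _ f g (arrow_square u)).
by exists v; split; apply: arrow_ext; rewrite ?arrow_srcM ?arrow_tgtM ?v1 ?v2.
Qed.

End ArrowCategory.

(** Convertible to [MorE_confl] when [W] is the class of admissible epimorphisms; for admissible
    monomorphisms the agreement with [MorM_confl] is a theorem. *)
Definition arrow_confl (C : preaddCat) (E : confl_class C) (W : mor_class C) :
    confl_class (arrow_cat W) :=
  fun a b c u v =>
    E _ _ _ (arrow_src u) (arrow_src v) /\ E _ _ _ (arrow_tgt u) (arrow_tgt v).

Definition ext_closed (C : preaddCat) (E : confl_class C) (W : mor_class C) :=
  forall (A1 A2 A3 B1 B2 B3 : C) (i : hom A1 A2) (p : hom A2 A3)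
    (i' : hom B1 B2) (p' : hom B2 B3)
    (a1 : hom A1 B1) (a2 : hom A2 B2) (a3 : hom A3 B3),
  E _ _ _ i p -> E _ _ _ i' p' -> a2 \oc i = i' \oc a1 -> a3 \oc p = p' \oc a2 ->
  W _ _ a1 -> W _ _ a3 -> W _ _ a2.

Section ArrowExact.
Context (C : preaddCat) (E : confl_class C) (W : mor_class C).
Arguments E {X Y Z} _ _ : rename.
Arguments W {X Y} _ : rename.
Context (hE : is_exact (@E)) (hW : ext_closed (@E) (@W)).
Context (hW0 : forall Z : C, is_zero_obj Z -> W (idm Z)).
Implicit Types a b c d : arrow_cat (@W).

Let AE := @arrow_confl C (@E) (@W).

Lemma arrow_zero : exists2 z : arrow_cat (@W), is_zero_obj z &
  is_zero_obj (asrc z) /\ is_zero_obj (atgt z).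
Proof.
have [[Z hZ] _] := exact_additive hE.
exists (Arrow (hW0 hZ)) => // a; split=> u; apply: arrow_ext.
- exact: (proj1 (hZ _)).
- exact: (proj1 (hZ _)).
- exact: (proj2 (hZ _)).
- exact: (proj2 (hZ _)).
Qed.

Lemma arrow_additive : additive_cat (arrow_cat (@W)).
Proof.
split; first by have [z hz _] := arrow_zero; exists z.
move=> a b.
have [_ hB] := exact_additive hE.
have [S [i1 [i2 [p1 [p2 hS]]]]] := hB (asrc a) (asrc b).
have [T [j1 [j2 [q1 [q2 hT]]]]] := hB (atgt a) (atgt b).
have hS' := biproduct_confl hE hS; have hT' := biproduct_confl hE hT.
case: (hS) => e11 e22 e12 e21 e; case: (hT) => f11 f22 f12 f21 f.
set w := j1 \oc amap a \oc p1 + j2 \oc amap b \oc p2.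
have w1 : w \oc i1 = j1 \oc amap a.
  by rewrite mcompDl (mcomp_eqr e11) (mcomp_eqr e21) mcompm1 mcompm0 addr0.
have w2 : w \oc i2 = j2 \oc amap b.
  by rewrite mcompDl (mcomp_eqr e12) (mcomp_eqr e22) mcompm1 mcompm0 add0r.
have w3 : q1 \oc w = amap a \oc p1.
  by rewrite mcompDr !mcompA f11 f12 !mcomp0m mcomp1m addr0.
have w4 : q2 \oc w = amap b \oc p2.
  by rewrite mcompDr !mcompA f22 f21 !mcomp0m mcomp1m add0r.
have hw : W w by apply: hW hS' hT' w1 (esym w4) (arrowP a) (arrowP b).
pose s : arrow_cat (@W) := Arrow hw.
have [I1 I11 I12] := @arrow_mkK C (@W) a s i1 j1 (esym w1).
have [I2 I21 I22] := @arrow_mkK C (@W) b s i2 j2 (esym w2).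
have [P1 P11 P12] := @arrow_mkK C (@W) s a p1 q1 w3.
have [P2 P21 P22] := @arrow_mkK C (@W) s b p2 q2 w4.
exists s, I1, I2, P1, P2; split; apply: arrow_ext;
  rewrite ?arrow_srcM ?arrow_tgtM ?I11 ?I12 ?I21 ?I22 ?P11 ?P12 ?P21 ?P22 //.
- change (arrow_src I1 \oc arrow_src P1 + arrow_src I2 \oc arrow_src P2 = idm S).
  by rewrite I11 P11 I21 P21.
- change (arrow_tgt I1 \oc arrow_tgt P1 + arrow_tgt I2 \oc arrow_tgt P2 = idm T).
  by rewrite I12 P12 I22 P22.
Qed.

Lemma arrow_kernel a b c (u : hom a b) (v : hom b c) : AE u v -> is_kernel u v.
Proof.
move=> [h1 h2]; split.
  by apply: arrow_ext; rewrite ?arrow_srcM ?arrow_tgtM (confl0 hE).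
move=> d t vt.
have [s1 [e1 _]] := proj2 (confl_kernel hE h1) _ _ (congr1 (@arrow_src _ _ _ _) vt).
have [s2 [e2 _]] := proj2 (confl_kernel hE h2) _ _ (congr1 (@arrow_tgt _ _ _ _) vt).
have [|s es1 es2] := @arrow_mkK _ _ d a s1 s2.
  apply: (confl_monic hE h2).
  by rewrite !mcompA e2 arrow_square arrow_square -mcompA e1.
exists s; split; first by apply: arrow_ext; rewrite ?arrow_srcM ?arrow_tgtM ?es1 ?es2.
move=> s' es'; apply: arrow_ext.
- by apply: (confl_monic hE h1); rewrite es1 e1 -es'.
- by apply: (confl_monic hE h2); rewrite es2 e2 -es'.
Qed.

Lemma arrow_cokernel a b c (u : hom a b) (v : hom b c) :
  AE u v -> is_cokernel u v.
Proof.
move=> [h1 h2]; split.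
  by apply: arrow_ext; rewrite ?arrow_srcM ?arrow_tgtM (confl0 hE).
move=> d t tu.
have [s1 [e1 _]] := proj2 (confl_cokernel hE h1) _ _ (congr1 (@arrow_src _ _ _ _) tu).
have [s2 [e2 _]] := proj2 (confl_cokernel hE h2) _ _ (congr1 (@arrow_tgt _ _ _ _) tu).
have [|s es1 es2] := @arrow_mkK _ _ c d s1 s2.
  apply: (confl_epic hE h1).
  by rewrite -!mcompA e1 -arrow_square mcompA e2 arrow_square.
exists s; split; first by apply: arrow_ext; rewrite ?arrow_srcM ?arrow_tgtM ?es1 ?es2.
move=> s' es'; apply: arrow_ext.
- by apply: (confl_epic hE h1); rewrite es1 e1 -es'.
- by apply: (confl_epic hE h2); rewrite es2 e2 -es'.
Qed.

Lemma arrow_pushout a b c d (i : hom a c) (p : hom c d) (f : hom a b) :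
  AE i p -> exists (w : arrow_cat (@W)) (g : hom b w) (u : hom c w) (h : hom w d),
    is_pushout f i g u /\ AE g h.
Proof.
move=> [hs ht].
have [S [g1 [u1 [h1 [po1 E1 eh1]]]]] := adm_mono_pushout hE (arrow_src f) hs.
have [T [g2 [u2 [h2 [po2 E2 eh2]]]]] := adm_mono_pushout hE (arrow_tgt f) ht.
have [] := proj2 po1 T (g2 \oc amap b) (u2 \oc amap c).
  rewrite -!mcompA -!arrow_square !mcompA.
  by rewrite (proj1 po2).
move=> w [[w1 w2] uw].
have w3 : amap d \oc h1 = h2 \oc w.
  apply: (is_pushout_epic po1); rewrite -!mcompA ?w1 ?w2.
    by rewrite (confl0 hE E1) mcompA (confl0 hE E2) mcompm0 mcomp0m.
  by rewrite eh1 mcompA eh2 arrow_square.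
(* Both push-outs keep their cokernels, so [w] is an extension of [amap d] by [amap b]. *)
have hw : W w := hW E1 E2 w1 w3 (arrowP b) (arrowP d).
pose s : arrow_cat (@W) := Arrow hw.
have [g g_1 g_2] := @arrow_mkK C (@W) b s g1 g2 (esym w1).
have [u u_1 u_2] := @arrow_mkK C (@W) c s u1 u2 (esym w2).
have [h h_1 h_2] := @arrow_mkK C (@W) s d h1 h2 (esym w3).
exists s, g, u, h; split; last by split; rewrite ?h_1 ?h_2 ?g_1 ?g_2.
split.
  apply: arrow_ext; rewrite ?arrow_srcM ?arrow_tgtM ?g_1 ?g_2 ?u_1 ?u_2.
    exact: (proj1 po1).
  exact: (proj1 po2).
move=> t x y exy.
have [z1 [[zg1 zu1] uz1]] := proj2 po1 _ _ _ (arrow_src_eq exy).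
have [z2 [[zg2 zu2] uz2]] := proj2 po2 _ _ _ (arrow_tgt_eq exy).
have [|z z_1 z_2] := @arrow_mkK _ _ s t z1 z2.
  apply: (is_pushout_epic po1); rewrite -!mcompA ?w1 ?w2.
    by rewrite (mcompA z2) zg2 zg1 arrow_square.
  by rewrite (mcompA z2) zu2 zu1 arrow_square.
exists z; split.
  by split; apply: arrow_ext;
    rewrite ?arrow_srcM ?arrow_tgtM ?g_1 ?g_2 ?u_1 ?u_2 ?z_1 ?z_2.
move=> z' [ex ey]; apply: arrow_ext; rewrite ?z_1 ?z_2.
  by apply: uz1; rewrite -g_1 -u_1 -ex -ey.
by apply: uz2; rewrite -g_2 -u_2 -ex -ey.
Qed.

(** Passing to the opposite category also exchanges the source and the target of every arrow, so
    this is not a convertible instance of [arrow_pushout] and the argument is carried out again. *)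
Lemma arrow_pullback a b c d (i : hom d c) (p : hom c a) (f : hom b a) :
  AE i p -> exists (w : arrow_cat (@W)) (g : hom w b) (u : hom w c) (h : hom d w),
    is_pullback f p g u /\ AE h g.
Proof.
move=> [hs ht].
have [S [g1 [u1 [h1 [po1 E1 eh1]]]]] := adm_epi_pullback hE (arrow_src f) hs.
have [T [g2 [u2 [h2 [po2 E2 eh2]]]]] := adm_epi_pullback hE (arrow_tgt f) ht.
have [] := proj2 po2 S (amap b \oc g1) (amap c \oc u1).
  rewrite !mcompA !arrow_square -!mcompA.
  by rewrite (proj1 po1).
move=> w [[w1 w2] uw].
have w3 : w \oc h1 = h2 \oc amap d.
  apply: (is_pullback_monic po2); rewrite !mcompA ?w1 ?w2.
    by rewrite -mcompA (confl0 hE E1) (confl0 hE E2) mcompm0 mcomp0m.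
  by rewrite -mcompA eh1 eh2 arrow_square.
have hw : W w := hW E1 E2 w3 (esym w1) (arrowP d) (arrowP b).
pose s : arrow_cat (@W) := Arrow hw.
have [g g_1 g_2] := @arrow_mkK C (@W) s b g1 g2 w1.
have [u u_1 u_2] := @arrow_mkK C (@W) s c u1 u2 w2.
have [h h_1 h_2] := @arrow_mkK C (@W) d s h1 h2 (esym w3).
exists s, g, u, h; split; last by split; rewrite ?h_1 ?h_2 ?g_1 ?g_2.
split.
  apply: arrow_ext; rewrite ?arrow_srcM ?arrow_tgtM ?g_1 ?g_2 ?u_1 ?u_2.
    exact: (proj1 po1).
  exact: (proj1 po2).
move=> t x y exy.
have [z1 [[zg1 zu1] uz1]] := proj2 po1 _ _ _ (arrow_src_eq exy).
have [z2 [[zg2 zu2] uz2]] := proj2 po2 _ _ _ (arrow_tgt_eq exy).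
have [|z z_1 z_2] := @arrow_mkK _ _ t s z1 z2.
  apply: (is_pullback_monic po2); rewrite !mcompA ?w1 ?w2.
    by rewrite zg2 -(mcompA (amap b)) zg1 arrow_square.
  by rewrite zu2 -(mcompA (amap c)) zu1 arrow_square.
exists z; split.
  by split; apply: arrow_ext;
    rewrite ?arrow_srcM ?arrow_tgtM ?g_1 ?g_2 ?u_1 ?u_2 ?z_1 ?z_2.
move=> z' [ex ey]; apply: arrow_ext; rewrite ?z_1 ?z_2.
  by apply: uz1; rewrite -g_1 -u_1 -ex -ey.
by apply: uz2; rewrite -g_2 -u_2 -ex -ey.
Qed.

(** By the Noether isomorphism on each component, the arrow between the cokernels of [j i] is an
    extension of [amap e] by [amap c], hence lies in [W]. *)
Lemma arrow_comp_mono a b c d e (i : hom a b) (p : hom b c)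
    (j : hom b d) (q : hom d e) :
  AE i p -> AE j q -> adm_mono AE (j \oc i).
Proof.
move=> [i1 i2] [j1 j2].
have [R1 [r1 [k1 [l1 [r1E k1E ek1 el1]]]]] := confl_comp_mono hE i1 j1.
have [R2 [r2 [k2 [l2 [r2E k2E ek2 el2]]]]] := confl_comp_mono hE i2 j2.
have : r2 \oc amap d \oc (arrow_src j \oc arrow_src i) = 0.
  rewrite -mcompA (mcompA (amap d)) -!arrow_square -(mcompA (arrow_tgt j)).
  by rewrite -arrow_square !mcompA -(mcompA r2) (confl0 hE r2E) mcomp0m.
case/(proj2 (confl_cokernel hE r1E)) => w [ew _].
have wk : w \oc k1 = k2 \oc amap c.
  apply: (confl_epic hE i1).
  rewrite -!mcompA ek1 -arrow_square !mcompA ew ek2 -!mcompA.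
  by rewrite arrow_square.
have wl : amap e \oc l1 = l2 \oc w.
  apply: (confl_epic hE r1E).
  by rewrite -!mcompA ew el1 mcompA el2 arrow_square.
have hw : W w := hW k1E k2E wk wl (arrowP c) (arrowP e).
have [r rs rt] := @arrow_mkK C (@W) d (Arrow hw) r1 r2 (esym ew).
by exists (Arrow hw), r; split; rewrite ?rs ?rt.
Qed.

Lemma arrow_comp_epi a b c d e (i : hom a b) (p : hom b c)
    (j : hom d c) (q : hom c e) :
  AE i p -> AE j q -> adm_epi AE (q \oc p).
Proof.
move=> [i1 i2] [j1 j2].
have [R1 [r1 [k1 [l1 [r1E k1E ek1 el1]]]]] := confl_comp_epi hE i1 j1.
have [R2 [r2 [k2 [l2 [r2E k2E ek2 el2]]]]] := confl_comp_epi hE i2 j2.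
have : arrow_tgt q \oc arrow_tgt p \oc (amap b \oc r1) = 0.
  rewrite -mcompA (mcompA (arrow_tgt p)) arrow_square !mcompA arrow_square.
  by rewrite -(mcompA (amap e)) -(mcompA (amap e)) (confl0 hE r1E) mcompm0.
case/(proj2 (confl_kernel hE r2E)) => w [ew _].
have wk : w \oc k1 = k2 \oc amap a.
  apply: (confl_monic hE r2E).
  by rewrite !mcompA ew ek2 -mcompA ek1 arrow_square.
have wl : amap d \oc l1 = l2 \oc w.
  apply: (confl_monic hE j2).
  rewrite !mcompA el2 arrow_square -!mcompA ew el1 !mcompA.
  by rewrite arrow_square.
have hw : W w := hW k1E k2E wk wl (arrowP a) (arrowP d).
have [r rs rt] := @arrow_mkK C (@W) (Arrow hw) b r1 r2 ew.
by exists (Arrow hw), r; split; rewrite ?rs ?rt.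
Qed.

Lemma arrow_exact : is_exact AE.
Proof.
split.
- exact: arrow_additive.
- by move=> a b c u v h; split; [exact: arrow_kernel | exact: arrow_cokernel].
- move=> a b c a' b' c' i p i' p' u v w [h1 h2].
  move=> /arrow_iso[u1 u2] /arrow_iso[v1 v2] /arrow_iso[w1 w2] e1 e2; split.
  + by apply: (exact_iso_closed hE h1 u1 v1 w1); rewrite -!arrow_srcM ?e1 ?e2.
  + by apply: (exact_iso_closed hE h2 u2 v2 w2); rewrite -!arrow_tgtM ?e1 ?e2.
- move=> a; have [z _ [z1 z2]] := arrow_zero.
  by exists z, 0; split; exact: confl_id0.
- move=> a; have [z _ [z1 z2]] := arrow_zero.
  by exists z, 0; split; exact: confl_0id.
- by move=> a b d i j [c [p hip]] [e [q hjq]]; exact: arrow_comp_mono hip hjq.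
- by move=> b c e p q [a [i hip]] [d [j hjq]]; exact: arrow_comp_epi hip hjq.
- move=> a b c i f [d [p hip]].
  have [w [g [u [h [hpo hgh]]]]] := arrow_pushout f hip.
  by exists w, g, u; split=> //; exists d, h.
- move=> a b c p f [d [i hip]].
  have [w [g [u [h [hpo hgh]]]]] := arrow_pullback f hip.
  by exists w, g, u; split=> //; exists d, h.
Qed.

End ArrowExact.

(** * Injective and projective objects, and the horseshoe lemma *)

Lemma inj_obj_retract (C : preaddCat) (E : confl_class C) (X I : C)
    (s : hom X I) (r : hom I X) : r \oc s = idm X -> inj_obj E I -> inj_obj E X.
Proof.
move=> e hI A B i f /(hI _ _ i (s \oc f))[g eg]; exists (r \oc g).
by rewrite -mcompA eg mcompA e mcomp1m.
Qed.

Lemma proj_obj_retract (C : preaddCat) (E : confl_class C) (X P : C)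
    (s : hom X P) (r : hom P X) : r \oc s = idm X -> proj_obj E P -> proj_obj E X.
Proof.
move=> e hP A B p f /(hP _ _ p (f \oc r))[g eg]; exists (g \oc s).
by rewrite mcompA eg -mcompA e mcompm1.
Qed.

Lemma proj_obj_op (C : preaddCat) (E : confl_class C) (P : C) :
  proj_obj E P -> @inj_obj (opcat C) (opconfl E) P.
Proof. by move=> hP X Y i f hi; exact: hP Y X i f hi. Qed.

Lemma projinj_retract (C : preaddCat) (E : confl_class C) (X P : C)
    (s : hom X P) (r : hom P X) : r \oc s = idm X -> projinj E P -> projinj E X.
Proof.
move=> e [hp hi]; split; first exact: proj_obj_retract e hp.
exact: inj_obj_retract e hi.
Qed.

Section Horseshoe.
Context (C : preaddCat) (E : confl_class C) (hE : is_exact E).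

(** Injectivity of [I1] extends [j1] along [i] to [m]; the map with components [m] and [j3 p] then
    compares the given conflation with the split one, and the 3 x 3 lemma does the rest. *)
Lemma horseshoe_inj (A1 A2 A3 I1 I2 I3 S1 S3 : C)
    (i : hom A1 A2) (p : hom A2 A3)
    (j1 : hom A1 I1) (q1 : hom I1 S1) (j3 : hom A3 I3) (q3 : hom I3 S3)
    (i1 : hom I1 I2) (i2 : hom I3 I2) (p1 : hom I2 I1) (p2 : hom I2 I3) :
  E i p -> E j1 q1 -> E j3 q3 -> inj_obj E I1 -> is_biproduct i1 i2 p1 p2 ->
  exists (S2 : C) (j2 : hom A2 I2) (q2 : hom I2 S2) (k : hom S1 S2) (l : hom S2 S3),
    [/\ E j2 q2, E k l & [/\ j2 \oc i = i1 \oc j1, p2 \oc j2 = j3 \oc p,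
      k \oc q1 = q2 \oc i1 & l \oc q2 = q3 \oc p2]].
Proof.
move=> hip h1 h3 hI hB.
have [m em] := hI _ _ i j1 (confl_mono hip).
have [e11 e22 e12 e21 e] := hB.
set j2 := i1 \oc m + i2 \oc j3 \oc p.
have ej1 : j2 \oc i = i1 \oc j1.
  by rewrite mcompDl -!mcompA em (confl0 hE hip) !mcompm0 addr0.
have ej2 : p2 \oc j2 = j3 \oc p.
  by rewrite mcompDr !mcompA e21 e22 mcomp0m mcomp1m add0r.
have hB' := biproduct_confl hE hB.
have [[S2 [q2 h2]] H] := three_by_three_mono hE hip hB' ej1 (esym ej2) h1 h3.
have : q2 \oc i1 \oc j1 = 0 by rewrite -mcompA -ej1 mcompA (confl0 hE h2) mcomp0m.
case/(proj2 (confl_cokernel hE h1)) => k [ek _].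
have : q3 \oc p2 \oc j2 = 0 by rewrite -mcompA ej2 mcompA (confl0 hE h3) mcomp0m.
case/(proj2 (confl_cokernel hE h2)) => l [el _].
exists S2, j2, q2, k, l; split=> //.
exact: H (confl_cokernel hE h2) ek el.
Qed.

End Horseshoe.

Section HorseshoeDual.
Context (C : preaddCat) (E : confl_class C) (hE : is_exact E).

Lemma horseshoe_proj (A1 A2 A3 P1 P2 P3 K1 K3 : C)
    (i : hom A1 A2) (p : hom A2 A3)
    (k1 : hom K1 P1) (q1 : hom P1 A1) (k3 : hom K3 P3) (q3 : hom P3 A3)
    (i1 : hom P1 P2) (i2 : hom P3 P2) (p1 : hom P2 P1) (p2 : hom P2 P3) :
  E i p -> E k1 q1 -> E k3 q3 -> proj_obj E P3 -> is_biproduct i1 i2 p1 p2 ->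
  exists (K2 : C) (k2 : hom K2 P2) (q2 : hom P2 A2) (k : hom K1 K2) (l : hom K2 K3),
    [/\ E k2 q2, E k l & [/\ q2 \oc i1 = i \oc q1, p \oc q2 = q3 \oc p2,
      i1 \oc k1 = k2 \oc k & k3 \oc l = p2 \oc k2]].
Proof.
move=> hip h1 h3 hP [e11 e22 e12 e21 e].
have hB : @is_biproduct (opcat C) _ _ _ p2 p1 i2 i1 by split=> //; rewrite addrC.
have [K2 [q2 [k2 [l [k [H1 H2 [H3 H4 H5 H6]]]]]]] :=
  @horseshoe_inj (opcat C) _ (is_exact_op hE) _ _ _ _ P2 _ _ _ p i q3 k3 q1 k1
    _ _ _ _ hip h3 h1 (proj_obj_op hP) hB.
by exists K2, k2, q2, k, l.
Qed.

End HorseshoeDual.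

Section ArrowInjective.
Context (C : preaddCat) (E : confl_class C) (W : mor_class C).
Arguments E {X Y Z} _ _ : rename.
Arguments W {X Y} _ : rename.
Context (hE : is_exact (@E)).
Implicit Types a b c : arrow_cat (@W).

Let AE := @arrow_confl C (@E) (@W).

(** The components [f0] and [g] extend those of [f] separately. The defect [amap a f0 - g amap c]
    kills [u], so it factors through the cokernel [v]; lifted along the section [s], it is
    subtracted from the source component, which does not affect the restriction along [u]. *)
Lemma arrow_inj_split a (s : hom (atgt a) (asrc a)) :
  amap a \oc s = idm (atgt a) ->
  inj_obj (@E) (asrc a) -> inj_obj (@E) (atgt a) -> inj_obj AE a.
Proof.
move=> es h1 h2 b c u f [d [v [uv1 uv2]]].
have [g eg] := h2 _ _ _ (arrow_tgt f) (confl_mono uv2).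
have [f0 ef0] := h1 _ _ _ (arrow_src f) (confl_mono uv1).
have : (amap a \oc f0 - g \oc amap c) \oc arrow_src u = 0.
  rewrite mcompBl -!mcompA ef0 -arrow_square -arrow_square mcompA eg.
  by rewrite subrr.
case/(proj2 (confl_cokernel hE uv1)) => w [ew _].
have [|h h1' h2'] := @arrow_mkK _ _ c a (f0 - s \oc w \oc arrow_src v) g.
  by rewrite mcompBr !mcompA es mcomp1m ew opprB addrC subrK.
exists h; apply: arrow_ext; rewrite ?arrow_srcM ?arrow_tgtM ?h1' ?h2' //.
by rewrite mcompBl ef0 -!mcompA (confl0 hE uv1) !mcompm0 subr0.
Qed.

(** The defect is now corrected on targets: it factors through the source of [d], and since [amap d]
    is an admissible monomorphism, injectivity of the target of [a] extends it to the target of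
    [d]. *)
Lemma arrow_inj_mono a :
  (forall (X Y : C) (f : hom X Y), W f -> adm_mono (@E) f) ->
  inj_obj (@E) (asrc a) -> inj_obj (@E) (atgt a) -> inj_obj AE a.
Proof.
move=> hW h1 h2 b c u f [d [v [uv1 uv2]]].
have [f1 ef1] := h1 _ _ _ (arrow_src f) (confl_mono uv1).
have [g0 eg0] := h2 _ _ _ (arrow_tgt f) (confl_mono uv2).
have : (amap a \oc f1 - g0 \oc amap c) \oc arrow_src u = 0.
  rewrite mcompBl -!mcompA ef1 -arrow_square -arrow_square mcompA eg0.
  by rewrite subrr.
case/(proj2 (confl_cokernel hE uv1)) => w [ew _].
have [w' ew'] := h2 _ _ _ w (hW _ _ _ (arrowP d)).
have [|h h1' h2'] := @arrow_mkK _ _ c a f1 (g0 + w' \oc arrow_tgt v).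
  by rewrite mcompDl -mcompA arrow_square mcompA ew' ew addrC subrK.
exists h; apply: arrow_ext; rewrite ?arrow_srcM ?arrow_tgtM ?h1' ?h2' //.
by rewrite mcompDl eg0 -!mcompA (confl0 hE uv2) !mcompm0 addr0.
Qed.

(** Here the defect lifts to the kernel [u], and the retraction [r] carries it to the target
    component, where it is subtracted. *)
Lemma arrow_proj_split a (r : hom (atgt a) (asrc a)) :
  r \oc amap a = idm (asrc a) ->
  proj_obj (@E) (asrc a) -> proj_obj (@E) (atgt a) -> proj_obj AE a.
Proof.
move=> er h1 h2 c b v f [d [u [uv1 uv2]]].
have [f' ef] := h1 _ _ _ (arrow_src f) (confl_epi uv1).
have [g0 eg0] := h2 _ _ _ (arrow_tgt f) (confl_epi uv2).
have : arrow_tgt v \oc (g0 \oc amap a - amap c \oc f') = 0.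
  rewrite mcompBr !mcompA eg0 arrow_square arrow_square -(mcompA (amap b)) ef.
  by rewrite subrr.
case/(proj2 (confl_kernel hE uv2)) => w [ew _].
have [|h h1' h2'] := @arrow_mkK _ _ a c f' (g0 - arrow_tgt u \oc w \oc r).
  by rewrite mcompBl (mcomp_eqr er) mcompm1 ew opprB addrC subrK.
exists h; apply: arrow_ext; rewrite ?arrow_srcM ?arrow_tgtM ?h1' ?h2' //.
by rewrite mcompBr eg0 !mcompA (confl0 hE uv2) !mcomp0m subr0.
Qed.

(** The defect lands in the target of the kernel [d]; since [amap d] is an admissible epimorphism,
    projectivity of the source of [a] lifts it to the source of [d], where it corrects the source
    component. *)
Lemma arrow_proj_epi a :
  (forall (X Y : C) (f : hom X Y), W f -> adm_epi (@E) f) ->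
  proj_obj (@E) (asrc a) -> proj_obj (@E) (atgt a) -> proj_obj AE a.
Proof.
move=> hW h1 h2 c b v f [d [u [uv1 uv2]]].
have [f0 ef0] := h1 _ _ _ (arrow_src f) (confl_epi uv1).
have [g eg] := h2 _ _ _ (arrow_tgt f) (confl_epi uv2).
have : arrow_tgt v \oc (g \oc amap a - amap c \oc f0) = 0.
  rewrite mcompBr !mcompA eg arrow_square arrow_square -(mcompA (amap b)) ef0.
  by rewrite subrr.
case/(proj2 (confl_kernel hE uv2)) => w [ew _].
have [w' ew'] := h1 _ _ _ w (hW _ _ _ (arrowP d)).
have [|h h1' h2'] := @arrow_mkK _ _ a c (f0 + arrow_src u \oc w') g.
  by rewrite mcompDr mcompA -arrow_square -mcompA ew' ew addrC subrK.
exists h; apply: arrow_ext; rewrite ?arrow_srcM ?arrow_tgtM ?h1' ?h2' //.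
by rewrite mcompDr ef0 !mcompA (confl0 hE uv1) !mcomp0m addr0.
Qed.

End ArrowInjective.

(** * Frobenius structures on the two arrow categories *)

Section ArrowFrobenius.
Context (F : frobCat) (W : mor_class F).
Arguments W {X Y} _ : rename.
Implicit Types a b : arrow_cat (@W).

Let AE := @arrow_confl F (@confl F) (@W).
Let PI a := projinj (@confl F) (asrc a) /\ projinj (@confl F) (atgt a).

Lemma inj_projinj (X : F) : inj_obj (@confl F) X -> projinj (@confl F) X.
Proof. by move=> h; split=> //; apply/(frob_projinj (frobP F)). Qed.

Lemma proj_projinj (X : F) : proj_obj (@confl F) X -> projinj (@confl F) X.
Proof. by move=> h; split=> //; apply/(frob_projinj (frobP F)). Qed.

(** An injective object is a retract of any object it embeds into admissibly, and dually for
    projectives. As [PI] is stable under retracts, both classes coincide with [PI]. *)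
Lemma arrow_frobenius :
  is_exact AE ->
  (forall a, PI a -> projinj AE a) ->
  (forall a, exists (b c : arrow_cat (@W)) (i : hom a b) (p : hom b c),
     AE i p /\ PI b) ->
  (forall a, exists (c b : arrow_cat (@W)) (i : hom c b) (p : hom b a),
     AE i p /\ PI b) ->
  is_frobenius AE /\ forall a, projinj AE a <-> PI a.
Proof.
move=> hE hPI hinj hproj.
have retr a b (u : hom a b) (v : hom b a) : v \oc u = idm a -> PI b -> PI a.
  move=> e [h1 h2]; split.
    apply: (projinj_retract (s := arrow_src u) (r := arrow_src v)) h1.
    by rewrite -arrow_srcM e.
  apply: (projinj_retract (s := arrow_tgt u) (r := arrow_tgt v)) h2.
  by rewrite -arrow_tgtM e.
have injP a : inj_obj AE a -> PI a.
  have [b [c [i [p [hip hb]]]]] := hinj a.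
  by case/(_ _ _ i (idm a) (confl_mono hip)) => r er; exact: retr er hb.
have projP a : proj_obj AE a -> PI a.
  have [c [b [i [p [hip hb]]]]] := hproj a.
  by case/(_ _ _ p (idm a) (confl_epi hip)) => r er; exact: retr er hb.
split; last by move=> a; split=> [[_ /injP]|/hPI].
split=> // [a|a|a].
- have [b [c [i [p [hip /hPI[_ hb]]]]]] := hinj a.
  by exists b, c, i, p.
- have [c [b [i [p [hip /hPI[hb _]]]]]] := hproj a.
  by exists c, b, i, p.
- by split=> [/projP/hPI[]|/injP/hPI[]].
Qed.

End ArrowFrobenius.

Section MorFrobenius.
Context (F : frobCat).
Let hF := frob_exact (frobP F).

Lemma adm_mono_ext : ext_closed (@confl F) (adm_mono (@confl F)).
Proof.
move=> A1 A2 A3 B1 B2 B3 i p i' p' a1 a2 a3 h h' e1 e2 [C1 [c1 h1]] [C3 [c3 h3]].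
by have [] := three_by_three_mono hF h h' e1 e2 h1 h3.
Qed.

Lemma adm_epi_ext : ext_closed (@confl F) (adm_epi (@confl F)).
Proof.
move=> A1 A2 A3 B1 B2 B3 i p i' p' a1 a2 a3 h h' e1 e2 [C1 [c1 h1]] [C3 [c3 h3]].
by have [] := three_by_three_epi hF h h' e1 e2 h1 h3.
Qed.

(** One diagram serves both categories: its right half [p], [n], [l] embeds an admissible
    epimorphism into one between projective-injectives, and its left half [i], [m], [k] does so for
    an admissible monomorphism. *)
Lemma horseshoe_hull (A1 A2 A3 : F) (i : hom A1 A2) (p : hom A2 A3) :
  confl i p -> exists (I1 I2 I3 S1 S2 S3 : F)
    (j1 : hom A1 I1) (q1 : hom I1 S1) (j2 : hom A2 I2) (q2 : hom I2 S2)
    (j3 : hom A3 I3) (q3 : hom I3 S3)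
    (m : hom I1 I2) (n : hom I2 I3) (k : hom S1 S2) (l : hom S2 S3),
  [/\ [/\ confl j1 q1, confl j2 q2 & confl j3 q3], confl m n, confl k l,
    [/\ j2 \oc i = m \oc j1, n \oc j2 = j3 \oc p,
      k \oc q1 = q2 \oc m & l \oc q2 = q3 \oc n] &
    [/\ projinj (@confl F) I1, projinj (@confl F) I2 & projinj (@confl F) I3]].
Proof.
move=> hip.
have [I1 [S1 [j1 [q1 [h1 inj1]]]]] := frob_enough_inj (frobP F) A1.
have [I3 [S3 [j3 [q3 [h3 inj3]]]]] := frob_enough_inj (frobP F) A3.
have [_ hB] := exact_additive hF.
have [I2 [i1 [i2 [p1 [p2 hI2]]]]] := hB I1 I3.
have [S2 [j2 [q2 [k [l [H1 H2 [H3 H4 H5 H6]]]]]]] :=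
  horseshoe_inj hF hip h1 h3 inj1 hI2.
exists I1, I2, I3, S1, S2, S3, j1, q1, j2, q2; exists j3, q3, i1, p2, k, l.
have pi1 := inj_projinj inj1; have pi3 := inj_projinj inj3.
split=> //; first exact: (biproduct_confl hF hI2).
by split=> //; exact: (projinj_biproduct hI2 pi1 pi3).
Qed.

Lemma horseshoe_cover (A1 A2 A3 : F) (i : hom A1 A2) (p : hom A2 A3) :
  confl i p -> exists (P1 P2 P3 K1 K2 K3 : F)
    (k1 : hom K1 P1) (q1 : hom P1 A1) (k2 : hom K2 P2) (q2 : hom P2 A2)
    (k3 : hom K3 P3) (q3 : hom P3 A3)
    (m : hom P1 P2) (n : hom P2 P3) (k : hom K1 K2) (l : hom K2 K3),
  [/\ [/\ confl k1 q1, confl k2 q2 & confl k3 q3], confl m n, confl k l,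
    [/\ q2 \oc m = i \oc q1, p \oc q2 = q3 \oc n,
      m \oc k1 = k2 \oc k & k3 \oc l = n \oc k2] &
    [/\ projinj (@confl F) P1, projinj (@confl F) P2 & projinj (@confl F) P3]].
Proof.
move=> hip.
have [K1 [P1 [k1 [q1 [h1 proj1]]]]] := frob_enough_proj (frobP F) A1.
have [K3 [P3 [k3 [q3 [h3 proj3]]]]] := frob_enough_proj (frobP F) A3.
have [_ hB] := exact_additive hF.
have [P2 [i1 [i2 [p1 [p2 hP2]]]]] := hB P1 P3.
have [K2 [k2 [q2 [k [l [H1 H2 [H3 H4 H5 H6]]]]]]] :=
  horseshoe_proj hF hip h1 h3 proj3 hP2.
exists P1, P2, P3, K1, K2, K3, k1, q1, k2, q2; exists k3, q3, i1, p2, k, l.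
have pi1 := proj_projinj proj1; have pi3 := proj_projinj proj3.
split=> //; first exact: (biproduct_confl hF hP2).
by split=> //; exact: (projinj_biproduct hP2 pi1 pi3).
Qed.

Lemma MorE_frobenius : is_frobenius (@MorE_confl F) /\
  forall a : MorE F, projinj (@MorE_confl F) a <-> Proj_MorE a.
Proof.
apply: (@arrow_frobenius F (adm_epi (@confl F))).
- apply: arrow_exact hF adm_epi_ext _ => Z _; exact: exact_id_epi.
- move=> a [[p1 i1] [p2 i2]]; split.
    exact: (arrow_proj_epi hF).
  (* An admissible epimorphism onto a projective object splits. *)
  have [s es] := p2 _ _ _ (idm _) (arrowP a).
  exact: (arrow_inj_split hF es).
- move=> a; have [K [kk hk]] := arrowP a.
  have [I1 [I2 [I3 [S1 [S2 [S3 [j1 [q1 [j2 [q2 H]]]]]]]]]] := horseshoe_hull hk.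
  have [j3 [q3 [m [n [k [l [[h1 h2 h3] hmn hkl [e1 e2 e3 e4] [? ? ?]]]]]]]] := H.
  pose b : MorE F := Arrow (confl_epi hmn).
  pose c : MorE F := Arrow (confl_epi hkl).
  have [i i_1 i_2] := @arrow_mkK _ _ a b j2 j3 (esym e2).
  have [p p_1 p_2] := @arrow_mkK _ _ b c q2 q3 (esym e4).
  by exists b, c, i, p; split=> //; split; rewrite ?i_1 ?i_2 ?p_1 ?p_2.
- move=> a; have [K [kk hk]] := arrowP a.
  have [I1 [I2 [I3 [S1 [S2 [S3 [j1 [q1 [j2 [q2 H]]]]]]]]]] := horseshoe_cover hk.
  have [j3 [q3 [m [n [k [l [[h1 h2 h3] hmn hkl [e1 e2 e3 e4] [? ? ?]]]]]]]] := H.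
  pose b : MorE F := Arrow (confl_epi hmn).
  pose c : MorE F := Arrow (confl_epi hkl).
  have [i i_1 i_2] := @arrow_mkK _ _ c b j2 j3 e4.
  have [p p_1 p_2] := @arrow_mkK _ _ b a q2 q3 (esym e2).
  by exists c, b, i, p; split=> //; split; rewrite ?i_1 ?i_2 ?p_1 ?p_2.
Qed.

Lemma MorM_conflP (a b c : MorM F) (u : hom a b) (v : hom b c) :
  MorM_confl u v <-> @arrow_confl F (@confl F) (adm_mono (@confl F)) _ _ _ u v.
Proof.
split=> [[h1 h2 _]|[h1 h2]]; first by [].
have [Ka [qa ha]] := arrowP a.
have [Kb [qb hb]] := arrowP b.
have [Kc [qc hc]] := arrowP c.
have : qb \oc arrow_tgt u \oc amap a = 0.
  by rewrite -mcompA arrow_square mcompA (confl0 hF hb) mcomp0m.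
case/(proj2 (confl_cokernel hF ha)) => ku [eku _].
have : qc \oc arrow_tgt v \oc amap b = 0.
  by rewrite -mcompA arrow_square mcompA (confl0 hF hc) mcomp0m.
case/(proj2 (confl_cokernel hF hb)) => kv [ekv _].
split=> //; exists Ka, Kb, Kc, qa, qb, qc, ku, kv; split.
  by split; [move: ha | move: hb | move: hc]; exact: confl_cokernel.
split=> //.
have [_ H] := three_by_three_mono hF h1 h2 (esym (arrow_square u))
   (esym (arrow_square v)) ha hc.
exact: (H _ _ _ _ (confl_cokernel hF hb) eku ekv).
Qed.

(** An equality of classes, obtained by extensionality, so that the general results on [arrow_confl]
    apply after one rewriting. *)
Lemma MorM_conflE :
  @MorM_confl F = @arrow_confl F (@confl F) (adm_mono (@confl F)).
Proof.
apply: functional_extensionality_dep => a; apply: functional_extensionality_dep => b.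
apply: functional_extensionality_dep => c; apply: functional_extensionality_dep => u.
apply: functional_extensionality_dep => v; apply: propext; exact: MorM_conflP.
Qed.

Lemma MorM_frobenius : is_frobenius (@MorM_confl F) /\
  forall a : MorM F, projinj (@MorM_confl F) a <-> Proj_MorM a.
Proof.
rewrite MorM_conflE; apply: (@arrow_frobenius F (adm_mono (@confl F))).
- apply: arrow_exact hF adm_mono_ext _ => Z _; exact: exact_id_mono.
- move=> a [[p1 i1] [p2 i2]]; split; last exact: (arrow_inj_mono hF).
  (* An admissible monomorphism out of an injective object splits. *)
  have [r er] := i1 _ _ _ (idm _) (arrowP a).
  exact: (arrow_proj_split hF er).
- move=> a; have [K [kk hk]] := arrowP a.
  have [I1 [I2 [I3 [S1 [S2 [S3 [j1 [q1 [j2 [q2 H]]]]]]]]]] := horseshoe_hull hk.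
  have [j3 [q3 [m [n [k [l [[h1 h2 h3] hmn hkl [e1 e2 e3 e4] [? ? ?]]]]]]]] := H.
  pose b : MorM F := Arrow (confl_mono hmn).
  pose c : MorM F := Arrow (confl_mono hkl).
  have [i i_1 i_2] := @arrow_mkK _ _ a b j1 j2 e1.
  have [p p_1 p_2] := @arrow_mkK _ _ b c q1 q2 (esym e3).
  by exists b, c, i, p; split=> //; split; rewrite ?i_1 ?i_2 ?p_1 ?p_2.
- move=> a; have [K [kk hk]] := arrowP a.
  have [I1 [I2 [I3 [S1 [S2 [S3 [j1 [q1 [j2 [q2 H]]]]]]]]]] := horseshoe_cover hk.
  have [j3 [q3 [m [n [k [l [[h1 h2 h3] hmn hkl [e1 e2 e3 e4] [? ? ?]]]]]]]] := H.
  pose b : MorM F := Arrow (confl_mono hmn).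
  pose c : MorM F := Arrow (confl_mono hkl).
  have [i i_1 i_2] := @arrow_mkK _ _ c b j1 j2 (esym e3).
  have [p p_1 p_2] := @arrow_mkK _ _ b a q1 q2 e1.
  by exists c, b, i, p; split=> //; split; rewrite ?i_1 ?i_2 ?p_1 ?p_2.
Qed.

End MorFrobenius.

(** * Stable categories *)

Section Functors.
Context (C D : preaddCat) (F : functor C D).

Lemma fmap0 (X Y : C) : fmap F (0 : hom X Y) = 0.
Proof. by apply: (addrI (fmap F 0)); rewrite -fmap_add !addr0. Qed.

Lemma fmapN (X Y : C) (f : hom X Y) : fmap F (- f) = - fmap F f.
Proof. by apply: (addrI (fmap F f)); rewrite -fmap_add !subrr fmap0. Qed.

Lemma fmap_iso (X Y : C) (f : hom X Y) : is_iso f -> is_iso (fmap F f).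
Proof.
by move=> [g [e1 e2]]; exists (fmap F g); rewrite -!fmap_comp e1 e2 !fmap_id.
Qed.

Hypothesis full : forall (X Y : C) (g : hom (F X) (F Y)), exists f, fmap F f = g.
Hypothesis faithful : forall (X Y : C) (f g : hom X Y),
  fmap F f = fmap F g -> f = g.
Hypothesis dense : forall Y : D, exists (X : C) (e : hom (F X) Y), is_iso e.

Let G (Y : D) : C := projT1 (cid (dense Y)).
Let e (Y : D) : hom (F (G Y)) Y := projT1 (cid (projT2 (cid (dense Y)))).
Let he (Y : D) : is_iso (e Y) := projT2 (cid (projT2 (cid (dense Y)))).
Let d (Y : D) : hom Y (F (G Y)) := projT1 (cid (he Y)).
Let de (Y : D) : d Y \oc e Y = idm _ := proj1 (projT2 (cid (he Y))).
Let ed (Y : D) : e Y \oc d Y = idm _ := proj2 (projT2 (cid (he Y))).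
Let pre (X Y : C) (g : hom (F X) (F Y)) : hom X Y := projT1 (cid (full g)).
Let preK (X Y : C) (g : hom (F X) (F Y)) : fmap F (pre g) = g :=
  projT2 (cid (full g)).
Let Gmap (Y Y' : D) (g : hom Y Y') : hom (G Y) (G Y') :=
  pre (d Y' \oc g \oc e Y).

Let Gmap_id (Y : D) : Gmap (idm Y) = idm (G Y).
Proof. by apply: faithful; rewrite preK mcompm1 de fmap_id. Qed.

Let Gmap_comp (X Y Z : D) (g : hom Y Z) (f : hom X Y) :
  Gmap (g \oc f) = Gmap g \oc Gmap f.
Proof.
apply: faithful; rewrite fmap_comp !preK !mcompA.
by rewrite (mcomp_eqr (ed Y)) mcompm1.
Qed.

Let Gmap_add (X Y : D) (f g : hom X Y) : Gmap (f + g) = Gmap f + Gmap g.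
Proof. by apply: faithful; rewrite fmap_add !preK mcompDr mcompDl. Qed.

Lemma fully_faithful_reflect_iso (X Y : C) (f : hom X Y) :
  is_iso (fmap F f) -> is_iso f.
Proof.
move=> [g' [e1 e2]]; have [g eg] := full g'; exists g.
by split; apply: faithful; rewrite fmap_comp fmap_id eg.
Qed.

(** The quasi-inverse chooses a preimage of each object up to isomorphism and acts on maps by
    conjugation with these isomorphisms; faithfulness reduces its functor laws to identities in
    [D]. *)
Lemma fully_faithful_dense_equivalence : is_equivalence F.
Proof.
exists (Functor Gmap_id Gmap_comp Gmap_add); split.
  exists (fun X => pre (e (F X))); split.
    move=> X; exists (pre (d (F X))).
    by split; apply: faithful; rewrite fmap_comp !preK ?de ?ed fmap_id.
  move=> X Y f; apply: faithful; rewrite !fmap_comp /= !preK.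
  by rewrite !mcompA ed mcomp1m.
exists e; split; first exact: he.
by move=> X Y f /=; rewrite preK !mcompA ed mcomp1m.
Qed.

End Functors.

Section Triangles.
Context (C : preaddCat) (S : functor C C).
Implicit Types t : triangle S.

Definition triangle_mor t t' (a : hom (tX t) (tX t')) (b : hom (tY t) (tY t'))
    (c : hom (tZ t) (tZ t')) : Prop :=
  [/\ b \oc tf t = tf t' \oc a, c \oc tg t = tg t' \oc b
    & fmap S a \oc th t = th t' \oc c].

Lemma triangle_mor_comp t t' t''
    (a : hom (tX t) (tX t')) (b : hom (tY t) (tY t')) (c : hom (tZ t) (tZ t'))
    (a' : hom (tX t') (tX t'')) (b' : hom (tY t') (tY t''))
    (c' : hom (tZ t') (tZ t'')) :
  triangle_mor a b c -> triangle_mor a' b' c' ->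
  triangle_mor (a' \oc a) (b' \oc b) (c' \oc c).
Proof.
move=> [e1 e2 e3] [f1 f2 f3]; split.
- by rewrite -mcompA e1 !mcompA f1.
- by rewrite -mcompA e2 !mcompA f2.
- by rewrite fmap_comp -mcompA e3 !mcompA f3.
Qed.

Lemma triangle_mor_inv t t'
    (a : hom (tX t) (tX t')) (b : hom (tY t) (tY t')) (c : hom (tZ t) (tZ t'))
    (a' : hom (tX t') (tX t)) (b' : hom (tY t') (tY t))
    (c' : hom (tZ t') (tZ t)) :
  triangle_mor a b c -> a \oc a' = idm _ -> a' \oc a = idm _ ->
  b \oc b' = idm _ -> b' \oc b = idm _ -> c \oc c' = idm _ -> c' \oc c = idm _ ->
  triangle_mor a' b' c'.
Proof.
move=> [e1 e2 e3] aa' a'a bb' b'b cc' c'c; split.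
- exact: esym (square_inv e1 aa' b'b).
- exact: esym (square_inv e2 bb' c'c).
- by apply: (esym (square_inv e3 cc' _)); rewrite -fmap_comp a'a fmap_id.
Qed.

Lemma triangle_isoP t t' : triangle_iso t t' ->
  exists a b c a' b' c',
    [/\ @triangle_mor t t' a b c, @triangle_mor t' t a' b' c',
      [/\ a \oc a' = idm _, b \oc b' = idm _ & c \oc c' = idm _]
      & [/\ a' \oc a = idm _, b' \oc b = idm _ & c' \oc c = idm _]].
Proof.
move=> [a [b [c [[[a' [a1 a2]] [b' [b1 b2]] [c' [c1 c2]]] h]]]].
exists a, b, c, a', b', c'; split=> //.
exact: triangle_mor_inv h a2 a1 b2 b1 c2 c1.
Qed.

(** Completing a square to a morphism of triangles is invariant under isomorphism of triangles, so
    only standard triangles have to be treated. *)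
Lemma triangle_mor_conj t0 t t0' t' :
  triangle_iso t0 t -> triangle_iso t0' t' ->
  (forall a b, b \oc tf t0 = tf t0' \oc a -> exists c, triangle_mor a b c) ->
  forall a b, b \oc tf t = tf t' \oc a -> exists c, @triangle_mor t t' a b c.
Proof.
move=> /triangle_isoP[a1 [b1 [c1 [a2 [b2 [c2 [m1 m2 [k1 k2 _] _]]]]]]].
move=> /triangle_isoP[a1' [b1' [c1' [a2' [b2' [c2' [m1' m2' [k1' k2' _] _]]]]]]].
move=> h a b eab.
have [|c hc] := h (a2' \oc a \oc a1) (b2' \oc b \oc b1).
  case: m1 m2' => [e1 _ _] [e2 _ _].
  by rewrite -mcompA e1 !mcompA -e2 -(mcompA b2') eab !mcompA.
exists (c1' \oc c \oc c2).
have := triangle_mor_comp (triangle_mor_comp m2 hc) m1'.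
rewrite !mcompA k1' k2' !mcomp1m -!mcompA k1 k2 !mcompm1.
by rewrite !mcompA.
Qed.

Lemma weak_cokernel_conj t0 t : triangle_iso t0 t ->
  (forall T (s : hom (tY t0) T), s \oc tf t0 = 0 -> exists r, r \oc tg t0 = s) ->
  forall T (s : hom (tY t) T), s \oc tf t = 0 -> exists r, r \oc tg t = s.
Proof.
move=> /triangle_isoP[a1 [b1 [c1 [a2 [b2 [c2 [m1 m2 [k1 k2 _] _]]]]]]].
move=> h T s es; have [|r er] := h _ (s \oc b1).
  by case: m1 => e1 _ _; rewrite -mcompA e1 mcompA es mcomp0m.
exists (r \oc c2); case: m2 => _ e2 _.
by rewrite -mcompA e2 mcompA er -mcompA k2 mcompm1.
Qed.

Lemma triangle_iso_trans t t' t'' :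
  triangle_iso t t' -> triangle_iso t' t'' -> triangle_iso t t''.
Proof.
move=> [a [b [c [[ha hb hc] h]]]] [a' [b' [c' [[ha' hb' hc'] h']]]].
exists (a' \oc a), (b' \oc b), (c' \oc c).
by split; [split; exact: is_iso_comp | exact: triangle_mor_comp h h'].
Qed.

Lemma triangle_iso_refl t : triangle_iso t t.
Proof.
exists (idm _), (idm _), (idm _); split; first by split; exact: is_iso_id.
by split; rewrite ?fmap_id mcomp1m mcompm1.
Qed.

Lemma triangle_iso_third X Y Z Z' (f : hom X Y) (g : hom Y Z) (h : hom Z (S X))
    (g' : hom Y Z') (h' : hom Z' (S X)) (c : hom Z Z') :
  is_iso c -> c \oc g = g' -> h' \oc c = h ->
  triangle_iso (Tri f g h) (Tri f g' h').
Proof.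
move=> hc e1 e2; exists (idm X), (idm Y), c; split.
  by split=> //; exact: is_iso_id.
by split=> /=; rewrite ?fmap_id ?mcomp1m ?mcompm1.
Qed.

Lemma triangle_mor_third X Y Z Z' (f : hom X Y) (g : hom Y Z) (h : hom Z (S X))
    (g' : hom Y Z') (h' : hom Z' (S X)) (c : hom Z Z') :
  @triangle_mor (Tri f g h) (Tri f g' h') (idm X) (idm Y) c ->
  c \oc g = g' /\ h' \oc c = h.
Proof. by case=> /= _; rewrite fmap_id mcomp1m mcompm1 => -> ->. Qed.

Lemma triangle_iso_rotate t t' : triangle_iso t t' ->
  triangle_iso (Tri (tg t) (th t) (- fmap S (tf t)))
               (Tri (tg t') (th t') (- fmap S (tf t'))).
Proof.
move=> [a [b [c [[ha hb hc] [e1 e2 e3]]]]].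
exists b, c, (fmap S a); split; first by split=> //; exact: fmap_iso.
by split=> //=; rewrite mcompNr mcompNl -!fmap_comp e1.
Qed.

End Triangles.

(* If n = c' c - 1, then 1 - n is an inverse of c' c. *)
Lemma iso_of_square_zero (C : preaddCat) (Z Z' : C) (c : hom Z Z') (c' : hom Z' Z) :
  (c' \oc c - idm Z) \oc (c' \oc c - idm Z) = 0 ->
  (c \oc c' - idm Z') \oc (c \oc c' - idm Z') = 0 ->
  is_iso c.
Proof.
have inv (W : C) (u : hom W W) : (u - idm W) \oc (u - idm W) = 0 ->
    exists v, v \oc u = idm W /\ u \oc v = idm W.
  have [n ->] : exists n, u = idm W + n by exists (u - idm W); rewrite addrC subrK.
  rewrite [idm W + n]addrC addrK => nn.
  exists (idm W - n); rewrite !mcompDl !mcompDr !mcompNr !mcompNl nn.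
  rewrite !mcomp1m !mcompm1 oppr0 !addr0 !add0r; split.
    by rewrite addrAC subrr add0r.
  by rewrite addrC subrK.
move=> /inv[u [u1 _]] /inv[v [_ v2]].
rewrite mcompA in u1; rewrite -mcompA in v2.
exists (u \oc c'); split=> //.
(* The left inverse [u c'] and the right inverse [c' v] of [c] coincide. *)
have -> : u \oc c' = c' \oc v.
  by rewrite -[LHS]mcompm1 -v2 mcompA u1 mcomp1m.
exact: v2.
Qed.

Local Notation st := stable_mor.

Local Notation st_tri f g h :=
  (@Tri (stable _) (stable_shift _) _ _ _ (st f) (st g) (st h)).

(** * Stable morphisms and the shift *)

Section Stable.
Context (A : frobCat).
Let hA := frob_exact (frobP A).
Implicit Types X Y Z J : A.

Lemma stM X Y Z (g : hom Y Z) (f : hom X Y) : st g \oc st f = st (g \oc f).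
Proof. exact: stable_compE. Qed.

Lemma st_id X : st (idm X) = @idm (stable A) X.
Proof. by []. Qed.

Lemma stD X Y (f g : hom X Y) : st (f + g) = st f + st g.
Proof. exact: stable_classD. Qed.

Lemma st0 X Y : st (0 : hom X Y) = 0.
Proof. by apply: (addrI (st 0)); rewrite -stD !addr0. Qed.

Lemma stN X Y (f : hom X Y) : st (- f) = - st f.
Proof. by apply: (addrI (st f)); rewrite -stD !subrr st0. Qed.

Lemma st_surj X Y (s : @hom (stable A) X Y) : exists f : hom X Y, s = st f.
Proof. by exists (stable_repr s); rewrite [RHS]stable_reprK. Qed.

Lemma st_eq X Y J (f g : hom X Y) (d : hom X J) (r : hom J Y) :
  inj_obj (@confl A) J -> f - g = r \oc d -> st f = st g.
Proof.
move=> hJ e; apply/stable_classP; exists J, d, r; split=> //.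
exact: inj_projinj.
Qed.

(** A map through an injective object passes through the chosen hull of its source, because its
    first factor extends to that hull. *)
Lemma st_eqP X Y (f g : hom X Y) : st f = st g ->
  exists k : hom (hI X) Y, f - g = k \oc hi X.
Proof.
move/stable_classP=> [Q [a [b [[_ hQ] ->]]]].
have [a' <-] := hi_extend a hQ.
by exists (b \oc a'); rewrite mcompA.
Qed.

Lemma st_eq0P X Y (f : hom X Y) : st f = 0 ->
  exists k : hom (hI X) Y, f = k \oc hi X.
Proof. by rewrite -st0 => /st_eqP[k]; rewrite subr0; exists k. Qed.

Lemma hi_mono X : adm_mono (@confl A) (hi X).
Proof. exact: confl_mono (hi_hp_confl X). Qed.

Lemma st_zero Z : inj_obj (@confl A) Z -> @is_zero_obj (stable A) Z.
Proof.
move=> hZ X; split=> s; have [f ->] := st_surj s; rewrite -st0.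
- by apply: (st_eq (d := f) (r := idm Z) hZ); rewrite mcomp1m subr0.
- by apply: (st_eq (d := idm Z) (r := f) hZ); rewrite mcompm1 subr0.
Qed.

Lemma stable_additive : additive_cat (stable A).
Proof.
have [[Z hZ] hB] := exact_additive hA; split.
  exists Z => X; split=> s; have [f ->] := st_surj s; rewrite -st0.
    by rewrite (proj1 (hZ X) f).
  by rewrite (proj2 (hZ X) f).
move=> X Y; have [S [i1 [i2 [p1 [p2 [e11 e22 e12 e21 e]]]]]] := hB X Y.
exists S, (st i1), (st i2), (st p1), (st p2).
by split; rewrite !stM ?e11 ?e22 ?e12 ?e21 ?st0 // -stD e.
Qed.

(** The difference [m - m'] kills [j], hence equals [d q] for some [d], and then [e - e' = r d]
    passes through the injective [J']. This is the uniqueness of maps induced on cosyzygies. *)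
Lemma st_confl_uniq X J S T J' (j : hom X J) (q : hom J S) (r : hom J' T)
    (e e' : hom S T) (m m' : hom J J') :
  confl j q -> inj_obj (@confl A) J' -> e \oc q = r \oc m -> e' \oc q = r \oc m' ->
  m \oc j = m' \oc j -> st e = st e'.
Proof.
move=> hjq hJ' e1 e2 e3.
have : (m - m') \oc j = 0 by rewrite mcompBl e3 subrr.
case/(proj2 (confl_cokernel hA hjq)) => d [ed _].
apply: (st_eq (d := d) (r := r) hJ'); apply: (confl_epic hA hjq).
by rewrite mcompBl e1 e2 -mcompA ed mcompBr.
Qed.

Lemma confl_extend X J S X' J' S' (j : hom X J) (q : hom J S)
    (j' : hom X' J') (q' : hom J' S') (f : hom X X') :
  confl j q -> confl j' q' -> inj_obj (@confl A) J' ->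
  exists m e, m \oc j = j' \oc f /\ e \oc q = q' \oc m.
Proof.
move=> h h' hJ'; have [m em] := hJ' _ _ j (j' \oc f) (confl_mono h).
have : q' \oc m \oc j = 0 by rewrite -mcompA em mcompA (confl0 hA h') mcomp0m.
by case/(proj2 (confl_cokernel hA h)) => e [ee _]; exists m, e.
Qed.

(** Cosyzygies for two injective hulls of [X] are stably isomorphic: lifts in both directions
    compose to maps induced by extensions of the identity of [X]. *)
Lemma st_confl_iso X J S J' S' (j : hom X J) (q : hom J S)
    (j' : hom X J') (q' : hom J' S') (m : hom J J') (e : hom S S') :
  confl j q -> confl j' q' -> inj_obj (@confl A) J -> inj_obj (@confl A) J' ->
  m \oc j = j' -> e \oc q = q' \oc m -> is_iso (st e).
Proof.
move=> h h' hJ hJ' em ee.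
have [m' [e' [em' ee']]] := confl_extend (idm X) h' h hJ.
rewrite mcompm1 in em'; exists (st e'); rewrite !stM -!st_id; split.
- apply: (st_confl_uniq (r := q) (m := m' \oc m) (m' := idm J) h hJ).
  + by rewrite -mcompA ee !mcompA ee'.
  + by rewrite mcomp1m mcompm1.
  + by rewrite -mcompA em em' mcomp1m.
- apply: (st_confl_uniq (r := q') (m := m \oc m') (m' := idm J') h' hJ').
  + by rewrite -mcompA ee' !mcompA ee.
  + by rewrite mcomp1m mcompm1.
  + by rewrite -mcompA em' em mcomp1m.
Qed.

Lemma shift_st X Y (f : hom X Y) h :
  shift_lift f h -> fmap (stable_shift A) (st f) = st h.
Proof. exact: stable_shift_mapE. Qed.

(** Since [hI X] is also projective, a map of cosyzygies lifts to the hulls and then restricts to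
    the kernels. *)
Lemma shift_full X Y (s : @hom (stable A) (stable_shift A X) (stable_shift A Y)) :
  exists f : @hom (stable A) X Y, fmap (stable_shift A) f = s.
Proof.
have [h ->] := st_surj s.
have [pX _] := inj_projinj (@hI_inj A X).
have [g eg] := pX _ _ (hp Y) (h \oc hp X) (confl_epi (hi_hp_confl Y)).
have : hp Y \oc (g \oc hi X) = 0 by rewrite mcompA eg -mcompA hp_hi mcompm0.
case/(proj2 (confl_kernel hA (hi_hp_confl Y))) => f [ef _].
by exists (st f); apply: shift_st; exists g.
Qed.

(** If [h - h' = b a] passes through a projective, [b] lifts along [hp Y] to [b']; then
    [g - b' a hp X] lands in the kernel [Y], and this extends [f - f'] over [hi X]. *)
Lemma shift_faithful X Y (s t : @hom (stable A) X Y) :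
  fmap (stable_shift A) s = fmap (stable_shift A) t -> s = t.
Proof.
have [f ->] := st_surj s; have [f' ->] := st_surj t.
have [h hh] := shift_lift_exists f; have [h' hh'] := shift_lift_exists f'.
rewrite (shift_st hh) (shift_st hh') => /stable_classP[Q [a [b [[pQ _] eab]]]].
have [g [eg eh]] := shift_liftB hh hh'.
have [b' eb] := pQ _ _ _ b (confl_epi (hi_hp_confl Y)).
have : hp Y \oc (g - b' \oc a \oc hp X) = 0.
  by rewrite mcompBr -eh eab !mcompA eb subrr.
case/(proj2 (confl_kernel hA (hi_hp_confl Y))) => k [ek _].
apply: (st_eq (d := hi X) (r := k) (@hI_inj A X)).
apply: (confl_monic hA (hi_hp_confl Y)).
by rewrite mcompA ek mcompBl eg -!mcompA hp_hi !mcompm0 subr0.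
Qed.

Lemma shift_equivalence : is_equivalence (stable_shift A).
Proof.
apply: fully_faithful_dense_equivalence.
- exact: shift_full.
- exact: shift_faithful.
(* Density: the projective [P] is injective, so [Y] is a cosyzygy of the kernel [K]. *)
- move=> Y; have [K [P [k [q [hkq pP]]]]] := frob_enough_proj (frobP A) Y.
  have [_ iP] := proj_projinj pP.
  have [m [e [em ee]]] := confl_extend (idm K) (hi_hp_confl K) hkq iP.
  exists K, (st e); apply: (st_confl_iso (hi_hp_confl K) hkq (@hI_inj A K) iP _ ee).
  by rewrite em mcompm1.
Qed.

(** * Distinguished triangles and their axioms *)

Definition st_dist X Y Z (f : hom X Y) (g : hom Y Z) (h : hom Z (hS X)) : Prop :=
  @dist (stable_triang A) (st_tri f g h).

Lemma standard_dist X Y W (f : hom X Y) (g : hom Y W) (u : hom (hI X) W)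
    (h : hom W (hS X)) :
  is_pushout f (hi X) g u -> h \oc g = 0 -> h \oc u = hp X -> st_dist f g h.
Proof.
move=> hpo hg hu.
exists (st_tri f g h).
  by exists X, Y, W, f, g, u, h.
exact: triangle_iso_refl.
Qed.

Lemma dist_standard (t : triangle (stable_shift A)) :
  @dist (stable_triang A) t ->
  exists X Y W (f : hom X Y) (g : hom Y W) (u : hom (hI X) W) (h : hom W (hS X)),
    [/\ is_pushout f (hi X) g u, h \oc g = 0, h \oc u = hp X &
      triangle_iso (st_tri f g h) t].
Proof.
by move=> [_ [X [Y [W [f [g [u [h [h1 h2 h3 ->]]]]]]]] ht]; exists X, Y, W, f, g, u, h.
Qed.

Lemma dist_iso (t t' : triangle (stable_shift A)) :
  triangle_iso t t' -> @dist (stable_triang A) t -> @dist (stable_triang A) t'.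
Proof.
by move=> h [t0 ht0 h0]; exists t0 => //; exact: triangle_iso_trans h0 h.
Qed.

Lemma standard_exists X Y (f : hom X Y) :
  exists W (g : hom Y W) (u : hom (hI X) W) (h : hom W (hS X)),
    [/\ is_pushout f (hi X) g u, confl g h & h \oc u = hp X].
Proof. exact: (adm_mono_pushout hA f (hi_hp_confl X)). Qed.

(** An arbitrary conflation [X -> J -> S] with [J] injective may replace the chosen hull, provided
    that the connecting map is corrected by the comparison [e]. The two push-outs are stably
    isomorphic, since the composites of the comparison maps [w] and [w'] differ from the identities
    by maps through [J] and [hI X]. *)
Lemma dist_pushout X Y J S W (f : hom X Y) (j : hom X J) (q : hom J S)
    (g : hom Y W) (u : hom J W) (h : hom W S) (m : hom J (hI X)) (e : hom S (hS X)) :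
  confl j q -> inj_obj (@confl A) J -> is_pushout f j g u ->
  h \oc g = 0 -> h \oc u = q -> m \oc j = hi X -> e \oc q = hp X \oc m ->
  st_dist f g (e \oc h).
Proof.
move=> hjq hJ hpo hg hu em ee.
have [W' [g' [u' [h' [hpo' hgh' hu']]]]] := standard_exists f.
have hg' := confl0 hA hgh'.
have [m' [e' [em' ee']]] := confl_extend (idm X) (hi_hp_confl X) hjq hJ.
rewrite mcompm1 in em'.
have [|w [[wg wu] _]] := proj2 hpo _ g' (u' \oc m).
  by rewrite -mcompA em (proj1 hpo').
have [|w' [[wg' wu'] _]] := proj2 hpo' _ g (u \oc m').
  by rewrite -mcompA em' (proj1 hpo).
have hw : h' \oc w = e \oc h.
  apply: (is_pushout_epic hpo); rewrite -!mcompA ?wg ?wu.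
    by rewrite hg' hg mcompm0.
  by rewrite mcompA hu' hu ee.
apply: dist_iso (standard_dist hpo' hg' hu').
(* The comparison [m' m] agrees with the identity on [X]; the resulting [d] is the homotopy from
   which the factorization of [w' w - 1] through [J] is built. *)
have [d [ed _]] : exists! d, d \oc q = m' \oc m - idm J.
  apply: (proj2 (confl_cokernel hA hjq)).
  by rewrite mcompBl -mcompA em em' mcomp1m subrr.
have [d' [ed' _]] : exists! d, d \oc hp X = m \oc m' - idm (hI X).
  apply: hp_extend; by rewrite mcompBl -mcompA em' em mcomp1m subrr.
have eq1 : st (w' \oc w) = st (idm W).
  apply: (st_eq (r := u) (d := d \oc h) hJ).
  apply: (is_pushout_epic hpo); rewrite mcompBl mcomp1m -!mcompA ?wg ?wu.
    by rewrite wg' hg !mcompm0 subrr.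
  by rewrite (mcompA w') wu' hu ed mcompBr mcompm1 mcompA.
have eq2 : st (w \oc w') = st (idm W').
  apply: (st_eq (r := u') (d := d' \oc h') (@hI_inj A X)).
  apply: (is_pushout_epic hpo'); rewrite mcompBl mcomp1m -!mcompA ?wg' ?wu'.
    by rewrite wg hg' !mcompm0 subrr.
  by rewrite (mcompA w) wu hu' ed' mcompBr mcompm1 mcompA.
apply: (@triangle_iso_third _ _ _ _ _ _ _ _ _ _ _ (st w')).
- by exists (st w); rewrite !stM eq1 eq2.
- by rewrite stM wg'.
- by rewrite -hw stM -mcompA -stM eq2 stM mcompm1.
Qed.

(* The sign comes from the section g' - u m of the projection of the cone onto
   Z, which maps to - hp m in the shift. *)
Lemma dist_confl X Y Z (f : hom X Y) (g : hom Y Z) (m : hom Y (hI X))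
    (k : hom Z (hS X)) :
  confl f g -> m \oc f = hi X -> k \oc g = - (hp X \oc m) -> st_dist f g k.
Proof.
move=> hfg em ek.
have [W [g' [u [h [hpo hgh hu]]]]] := standard_exists f.
have hg := confl0 hA hgh.
have [|z [[zg zu] _]] := proj2 hpo _ g 0; first by rewrite (confl0 hA hfg) mcomp0m.
have [|n [[ng nu] _]] := proj2 hpo _ m (idm (hI X)); first by rewrite em mcomp1m.
have [s [es _]] : exists! s, s \oc g = g' - u \oc m.
  apply: (proj2 (confl_cokernel hA hfg)).
  by rewrite mcompBl -mcompA em (proj1 hpo) subrr.
(* With the section [s] of [z], the object [W] is the direct sum of [Z] and the injective [hI X], so
   [z] is a stable isomorphism. *)
have eq1 : z \oc s = idm Z.
  apply: (confl_epic hA hfg).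
  by rewrite -mcompA es mcompBr zg mcompA zu mcomp0m subr0 mcomp1m.
have eq2 : idm W - s \oc z = u \oc n.
  apply: (is_pushout_epic hpo); rewrite mcompBl mcomp1m -!mcompA ?zg ?zu ?ng ?nu.
    by rewrite es opprB addrC subrK.
  by rewrite mcompm0 mcompm1 subr0.
have ks : k = h \oc s.
  by apply: (confl_epic hA hfg); rewrite -mcompA es mcompBr mcompA hu hg sub0r.
have hiX := @hI_inj A X.
apply: dist_iso (standard_dist hpo hg hu).
apply: (@triangle_iso_third _ _ _ _ _ _ _ _ _ _ _ (st z)).
- exists (st s); rewrite !stM eq1; split=> //.
  exact: esym (st_eq hiX eq2).
- by rewrite stM zg.
- rewrite stM ks -mcompA -stM -[in RHS](mcompm1 h) -[RHS]stM.
  by rewrite (st_eq hiX eq2).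
Qed.

(** A standard triangle contains the conflation [Y -> W -> hS X], and [hi Y] extends over [g] by the
    push-out property. The sign produced by [dist_confl] is exactly that of the rotation. *)
Lemma dist_rotate (t : triangle (stable_shift A)) :
  @dist (stable_triang A) t ->
  @dist (stable_triang A) (Tri (tg t) (th t) (- fmap (stable_shift A) (tf t))).
Proof.
move=> /dist_standard[X [Y [W [f [g [u [h [hpo hg hu ht]]]]]]]].
apply: dist_iso (triangle_iso_rotate ht) _.
have [h0 [g0 [eg0 eh0]]] := shift_lift_exists f.
suff: st_dist g h (- h0).
  by rewrite /st_dist stN -(shift_st (ex_intro _ g0 (conj eg0 eh0))).
have [m [[mg mu] _]] := proj2 hpo _ _ _ (esym eg0).
apply: (@dist_confl _ _ _ g h m); rewrite ?mg //.
  exact: (pushout_confl hA (hi_hp_confl X) hpo hg hu).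
rewrite mcompNl; congr (- _); apply: (is_pushout_epic hpo); rewrite -!mcompA.
  by rewrite hg mg mcompm0 hp_hi.
by rewrite hu mu eh0.
Qed.

Lemma standard_mor X Y W X' Y' W' (f : hom X Y) (g : hom Y W) (u : hom (hI X) W)
    (h : hom W (hS X)) (f' : hom X' Y') (g' : hom Y' W') (u' : hom (hI X') W')
    (h' : hom W' (hS X')) (a : @hom (stable A) X X') (b : @hom (stable A) Y Y') :
  is_pushout f (hi X) g u -> h \oc g = 0 -> h \oc u = hp X ->
  is_pushout f' (hi X') g' u' -> h' \oc g' = 0 -> h' \oc u' = hp X' ->
  b \oc st f = st f' \oc a ->
  exists c, @triangle_mor _ _ (st_tri f g h) (st_tri f' g' h') a b c.
Proof.
move=> hpo hg hu hpo' hg' hu'.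
have [a0 ->] := st_surj a; have [b0 ->] := st_surj b.
move=> e; have [k ek] : exists k, b0 \oc f - f' \oc a0 = k \oc hi X.
  by apply: st_eqP; rewrite -!stM.
have [h0 [g0 [eg0 eh0]]] := shift_lift_exists a0.
(* The square commutes only up to [k hi X]; the term [g' k] absorbs this error, so that the two legs
   agree on [X]. *)
have [|c [[cg cu] _]] := proj2 hpo _ (g' \oc b0) (u' \oc g0 + g' \oc k).
  rewrite mcompDl -!mcompA eg0 -ek mcompBr !mcompA (proj1 hpo').
  by rewrite addrC subrK.
exists (st c); split; first exact: e.
  change (st c \oc st g = st g' \oc st b0); by rewrite !stM cg.
change (fmap (stable_shift A) (st a0) \oc st h = st h' \oc st c).
rewrite (shift_st (ex_intro _ g0 (conj eg0 eh0))) !stM; congr (st _).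
apply: (is_pushout_epic hpo); rewrite -!mcompA ?cg ?cu.
  by rewrite hg mcompm0 mcompA hg' mcomp0m.
by rewrite mcompDr !mcompA hu' hg' mcomp0m addr0 -mcompA hu.
Qed.

Lemma dist_mor (t t' : triangle (stable_shift A)) (a : hom (tX t) (tX t'))
    (b : hom (tY t) (tY t')) :
  @dist (stable_triang A) t -> @dist (stable_triang A) t' ->
  b \oc tf t = tf t' \oc a -> exists c, triangle_mor a b c.
Proof.
move=> /dist_standard[X [Y [W [f [g [u [h [hpo hg hu ht]]]]]]]].
move=> /dist_standard[X' [Y' [W' [f' [g' [u' [h' [hpo' hg' hu' ht']]]]]]]].
apply: (triangle_mor_conj ht ht') => {}a {}b.
exact: (standard_mor hpo hg hu hpo' hg' hu').
Qed.

Lemma dist_weak_cokernel (t : triangle (stable_shift A)) (T : stable A)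
    (s : hom (tY t) T) :
  @dist (stable_triang A) t -> s \oc tf t = 0 -> exists r, r \oc tg t = s.
Proof.
move=> /dist_standard[X [Y [W [f [g [u [h [hpo hg hu ht]]]]]]]].
apply: (weak_cokernel_conj ht) => {s}T' s es.
have [s0 es0] := st_surj (s : @hom (stable A) Y T').
have [k ek] : exists k, s0 \oc f = k \oc hi X.
  by apply: st_eq0P; rewrite -stM -es0.
have [r [[rg _] _]] := proj2 hpo _ _ _ ek.
by exists (st r); rewrite es0 -rg -stM.
Qed.

(** The map [c' c - 1] kills [g], hence equals [r h], while [h (c' c - 1) = 0]; its square therefore
    vanishes. The same holds for [c c' - 1]. *)
Lemma third_iso (X Y Z Z' : stable A) (g : hom Y Z) (h : hom Z X)
    (g' : hom Y Z') (h' : hom Z' X) (c : hom Z Z') (c' : hom Z' Z) :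
  (forall (T : stable A) (s : hom Z T), s \oc g = 0 -> exists r, r \oc h = s) ->
  (forall (T : stable A) (s : hom Z' T), s \oc g' = 0 -> exists r, r \oc h' = s) ->
  c \oc g = g' -> h' \oc c = h -> c' \oc g' = g -> h \oc c' = h' -> is_iso c.
Proof.
move=> w w' e1 e2 e1' e2'; apply: (@iso_of_square_zero _ _ _ c c').
- have /w[r er] : (c' \oc c - idm Z) \oc g = 0.
    by rewrite mcompBl -mcompA e1 e1' mcomp1m subrr.
  by rewrite -{1}er -mcompA mcompBr mcompA e2' e2 mcompm1 subrr mcompm0.
- have /w'[r er] : (c \oc c' - idm Z') \oc g' = 0.
    by rewrite mcompBl -mcompA e1' e1 mcomp1m subrr.
  by rewrite -{1}er -mcompA mcompBr mcompA e2 e2' mcompm1 subrr mcompm0.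
Qed.

Lemma dist_uniq (X Y Z Z' : stable A) (f : hom X Y) (g : hom Y Z)
    (h : hom Z (stable_shift A X)) (g' : hom Y Z') (h' : hom Z' (stable_shift A X)) :
  @dist (stable_triang A) (Tri f g h) -> @dist (stable_triang A) (Tri f g' h') ->
  exists c, [/\ is_iso c, c \oc g = g' & h' \oc c = h].
Proof.
move=> d1 d2.
have e : idm Y \oc f = f \oc idm X by rewrite mcomp1m mcompm1.
have [c /triangle_mor_third[c1 c2]] :=
  @dist_mor (Tri f g h) (Tri f g' h') (idm X) (idm Y) d1 d2 e.
have [c' /triangle_mor_third[c1' c2']] :=
  @dist_mor (Tri f g' h') (Tri f g h) (idm X) (idm Y) d2 d1 e.
exists c; split=> //; apply: (third_iso _ _ c1 c2 c1' c2').
- by move=> T s es; exact: (dist_weak_cokernel (dist_rotate d1) es).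
- by move=> T s es; exact: (dist_weak_cokernel (dist_rotate d2) es).
Qed.

Lemma dist_cone X Y (f : hom X Y) : exists Z (g : hom Y Z) (h : hom Z (hS X)),
  st_dist f g h.
Proof.
have [W [g [u [h [hpo hgh hu]]]]] := standard_exists f.
by exists W, g, h; apply: standard_dist hpo (confl0 hA hgh) hu.
Qed.

(** Rotating a cone on [f] three times and the given triangle twice yields two triangles on
    [- fmap (stable_shift A) f]. Their third terms are isomorphic by [dist_uniq], and the
    isomorphism descends because the shift is fully faithful. *)
Lemma dist_rotate_inv (X Y Z : stable A) (f : hom X Y) (g : hom Y Z)
    (h : hom Z (stable_shift A X)) :
  @dist (stable_triang A) (Tri g h (- fmap (stable_shift A) f)) ->
  @dist (stable_triang A) (Tri f g h).
Proof.
move=> d2; have [f0 ef] := st_surj f.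
have [Z' [g0 [h0 d1]]] := dist_cone f0; rewrite /st_dist -ef in d1.
have d1' := dist_rotate (dist_rotate (dist_rotate d1)).
have d2' := dist_rotate (dist_rotate d2).
have [C [hC C1 C2]] := dist_uniq d2' d1'.
have [c ec] := shift_full C.
have hc : is_iso c.
  apply: (@fully_faithful_reflect_iso _ _ (stable_shift A) shift_full shift_faithful).
  by rewrite ec.
have c1 : c \oc g = st g0.
  apply: shift_faithful; rewrite fmap_comp ec; apply: oppr_inj.
  by rewrite -mcompNr; exact: C1.
have c2 : st h0 \oc c = h.
  apply: shift_faithful; rewrite fmap_comp ec; apply: oppr_inj.
  by rewrite -mcompNl; exact: C2.
apply: dist_iso d1.
have [c' [cc1 cc2]] := hc.
apply: (@triangle_iso_third _ _ _ _ _ _ _ _ _ _ _ c').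
- by exists c.
- by rewrite -c1 mcompA cc1 mcomp1m.
- by rewrite -c2 -mcompA cc2 mcompm1.
Qed.

(* The triangle on g is built from a conflation starting with Y -> hI Z', so
   that all third vertices are iterated push-outs along f, g and hi. *)
Lemma octahedron_cones X Y Z (f : hom X Y) (g : hom Y Z) :
  exists (Z' X' Y' : A) (a : hom Y Z') (a' : hom Z' (hS X)) (b : hom Z X')
    (b' : hom X' (hS Y)) (c : hom Z Y') (c' : hom Y' (hS X))
    (u : hom Z' Y') (v : hom Y' X') (sa : hom (hS Y) (hS Z')) (sf : hom (hS X) (hS Y)),
  [/\ [/\ shift_lift a sa & shift_lift f sf],
    [/\ st_dist f a a', st_dist g b b', st_dist (g \oc f) c c' &
      st_dist u v (sa \oc b')]
    & [/\ u \oc a = c \oc g, c' \oc u = a', v \oc c = b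
        & st (b' \oc v) = st (sf \oc c')]].
Proof.
have [Z' [a [u1 [a' [po1 cf1 e1]]]]] := standard_exists f.
have [Y' [c [u [c' [po2 cf2 e2]]]]] := adm_mono_pushout hA g cf1.
have [X' [v [u2 [h [po3 cf3 e3]]]]] := standard_exists u.
have [S [q hq]] := exact_comp_mono hA (confl_mono cf1) (hi_mono Z').
have po4 := is_pushout_paste po2 po3.
have po5 := is_pushout_sym (is_pushout_paste (is_pushout_sym po1) (is_pushout_sym po2)).
have [|h2 [[h2b h2u] _]] := proj2 po4 _ 0 q.
  by rewrite mcomp0m (confl0 hA hq).
have [m [e [em ee]]] := confl_extend (idm Y) hq (hi_hp_confl Y) (@hI_inj A Y).
rewrite mcompm1 in em.
have [sa [g1 [eg1 esa]]] := shift_lift_exists a.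
have [sf [g2 [eg2 esf]]] := shift_lift_exists f.
have hc0 := confl0 hA cf2; have ha0 := confl0 hA cf1; have hv0 := confl0 hA cf3.
exists Z', X', Y', a, a', (v \oc c), (e \oc h2), c, c'.
exists u, v, sa, sf; split.
- by split; [exists g1 | exists g2].
- split.
  + exact: standard_dist po1 ha0 e1.
  + exact: dist_pushout hq (@hI_inj A Z') po4 h2b h2u em ee.
  + by apply: standard_dist po5 hc0 _; rewrite mcompA e2.
  + suff es : st (sa \oc (e \oc h2)) = st h.
      by rewrite /st_dist es; exact: standard_dist po3 hv0 e3.
    have [r [er _]] : exists! r, r \oc q = hp Z'.
      apply: (proj2 (confl_cokernel hA hq)).
      by rewrite mcompA hp_hi mcomp0m.
    have -> : h = r \oc h2.
      apply: (is_pushout_epic po4); rewrite -(mcompA r).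
        by rewrite h2b mcompA hv0 mcompm0 mcomp0m.
      by rewrite h2u er.
    (* Both [sa e] and [r] are induced on [S] by endomorphisms of [hI Z'] that agree on [Y]. *)
    rewrite mcompA -[LHS]stM -[RHS]stM; congr (_ \oc _).
    apply: (st_confl_uniq (r := hp Z') (m := g1 \oc m) (m' := idm _) hq (@hI_inj A Z')).
    * by rewrite -mcompA ee !mcompA esa.
    * by rewrite er mcompm1.
    * by rewrite -mcompA em eg1 mcomp1m.
- split=> //; first exact: esym (proj1 po2).
  (* Both [m hi u1] and [g2] extend [hi Y f] to [hI X]; their difference factors through [hp X] and
     exhibits [b' v - sf c'] as a map through [hI Y]. *)
  have [d [ed _]] : exists! d, d \oc hp X = m \oc hi Z' \oc u1 - g2.
    apply: hp_extend; rewrite mcompBl -!mcompA -(proj1 po1) eg2.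
    by rewrite (mcompA (hi Z')) mcompA em subrr.
  apply: (st_eq (r := hp Y) (d := d \oc c') (@hI_inj A Y)).
  apply: (is_pushout_epic po5); rewrite mcompBl -!mcompA.
    by rewrite h2b hc0 !mcompm0 subrr.
  have ev : v \oc (u \oc u1) = u2 \oc (hi Z' \oc u1).
    by rewrite !mcompA (proj1 po3).
  rewrite ev (mcompA h2) h2u (mcompA e) ee (mcompA c') e2 e1 ed esf.
  by rewrite mcompBr !mcompA.
Qed.

(** Cones are unique up to isomorphism, so the octahedron on the constructed cones is transported to
    the given ones by conjugation with [z], [y] and [x]. *)
Lemma dist_octahedron (X Y Z X' Y' Z' : stable A)
    (f : hom X Y) (a : hom Y Z') (a' : hom Z' (stable_shift A X))
    (g : hom Y Z) (b : hom Z X') (b' : hom X' (stable_shift A Y))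
    (c : hom Z Y') (c' : hom Y' (stable_shift A X)) :
  @dist (stable_triang A) (Tri f a a') -> @dist (stable_triang A) (Tri g b b') ->
  @dist (stable_triang A) (Tri (g \oc f) c c') ->
  exists (u : hom Z' Y') (v : hom Y' X'),
    @dist (stable_triang A) (Tri u v (fmap (stable_shift A) a \oc b')) /\
    [/\ u \oc a = c \oc g, c' \oc u = a', v \oc c = b
      & b' \oc v = fmap (stable_shift A) f \oc c'].
Proof.
have [f0 ->] := st_surj f; have [g0 ->] := st_surj g.
rewrite stM => d1 d2 d3.
have [Z1 [X1 [Y1 [a1 [a1' [b1 [b1' [c1 [c1' [u1 [v1 [sa [sf H]]]]]]]]]]]]] :=
  octahedron_cones f0 g0.
have [[hsa hsf] [k1 k2 k3 k4] [q1 q2 q3 q4]] := H.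
have [z [[z' [zz1 zz2]] za za']] := dist_uniq k1 d1.
have [x [hx xb xb']] := dist_uniq k2 d2.
have [y [[y' [yy1 yy2]] yc yc']] := dist_uniq k3 d3.
exists (y \oc st u1 \oc z'), (x \oc st v1 \oc y'); split.
  apply: dist_iso k4; exists z, y, x; split.
    by split=> //; [exists z' | exists y'].
  split.
  - change (y \oc st u1 = y \oc st u1 \oc z' \oc z).
    by rewrite -!mcompA zz1 mcompm1.
  - change (x \oc st v1 = x \oc st v1 \oc y' \oc y).
    by rewrite -!mcompA yy1 mcompm1.
  - change (fmap (stable_shift A) z \oc st (sa \oc b1') =
      fmap (stable_shift A) a \oc b' \oc x).
    rewrite -mcompA xb' -za fmap_comp (shift_st hsa) -mcompA; congr (_ \oc _).
    by rewrite stM.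
have za2 : z' \oc a = st a1 by rewrite -za mcompA zz1 mcomp1m.
have yc2 : y' \oc c = st c1 by rewrite -yc mcompA yy1 mcomp1m.
have za2' : st a1' \oc z' = a' by rewrite -za' -mcompA zz2 mcompm1.
have yc2' : st c1' \oc y' = c' by rewrite -yc' -mcompA yy2 mcompm1.
split.
- by rewrite -mcompA za2 -mcompA stM q1 -stM mcompA yc.
- by rewrite !mcompA yc' stM q2 za2'.
- by rewrite -mcompA yc2 -mcompA stM q3 xb.
- by rewrite !mcompA xb' stM q4 -stM -mcompA yc2' (shift_st hsf).
Qed.

Lemma dist_id X (Z : stable A) : is_zero_obj Z ->
  @dist (stable_triang A) (@Tri (stable A) (stable_shift A) X X Z
    (idm (X : stable A)) 0 0).
Proof.
move=> hZ.
(* The standard cone of the identity is [hI X], a zero object of the stable category. *)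
have hpo : is_pushout (idm X) (hi X) (hi X) (idm (hI X)).
  split; first by rewrite mcomp1m mcompm1.
  move=> T s t; rewrite mcompm1 => est; exists t; split; first by rewrite mcompm1.
  by move=> w [_]; rewrite mcompm1.
apply: dist_iso (standard_dist hpo (hp_hi X) (mcompm1 (hp X))).
have hI0 := st_zero (@hI_inj A X).
apply: (@triangle_iso_third _ _ _ _ _ _ _ _ _ _ _ (0 : @hom (stable A) (hI X) Z)).
- exists 0; split; rewrite mcomp0m.
    by rewrite (proj1 (hI0 _) (idm _)).
  by rewrite (proj1 (hZ _) (idm _)).
- by rewrite mcomp0m.
- by rewrite mcomp0m (proj2 (hI0 _) (st (hp X))).
Qed.

Theorem stable_triangulated : is_triangulated (stable_triang A).
Proof.
split.
- exact: stable_additive.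
- exact: shift_equivalence.
- exact: dist_iso.
- exact: dist_id.
- move=> X Y f; have [f0 ->] := st_surj f.
  by have [Z [g [h d]]] := dist_cone f0; exists Z, (st g), (st h).
- move=> X Y Z f g h; split; first exact: (@dist_rotate (Tri f g h)).
  exact: dist_rotate_inv.
- move=> X Y Z X' Y' Z' f g h f' g' h' a b d1 d2 e.
  by have [c [_ c1 c2]] := dist_mor d1 d2 e; exists c.
- exact: dist_octahedron.
Qed.

End Stable.

(** * Frobenius functors *)

Section TriangleFunctor.
Context (C D : preaddCat) (S : functor C C) (T : functor D D) (F : functor C D).
Context (phi : forall X : C, hom (F (S X)) (T (F X))).
Hypothesis phi_nat : forall (X Y : C) (f : hom X Y),
  phi Y \oc fmap F (fmap S f) = fmap T (fmap F f) \oc phi X.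

Definition triangle_image (t : triangle S) : triangle T :=
  Tri (fmap F (tf t)) (fmap F (tg t)) (phi (tX t) \oc fmap F (th t)).

Lemma triangle_image_iso (t t' : triangle S) :
  triangle_iso t t' -> triangle_iso (triangle_image t) (triangle_image t').
Proof.
move=> [a [b [c [[ha hb hc] [e1 e2 e3]]]]].
exists (fmap F a), (fmap F b), (fmap F c).
split; first by split; exact: fmap_iso.
split=> /=; rewrite -?fmap_comp ?e1 ?e2 //.
by rewrite mcompA -phi_nat -!mcompA -!fmap_comp e3.
Qed.

End TriangleFunctor.

Section StableFunctor.
Context (A B : frobCat) (F : functor A B) (hF : frobenius_functor F).

Lemma frobenius_functor_null (X Y : A) (f : hom X Y) :
  factors_projinj f -> factors_projinj (fmap F f).
Proof.
move=> [Q [a [b [hQ ->]]]]; exists (F Q), (fmap F a), (fmap F b).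
by split; [exact: (proj2 hF) | rewrite fmap_comp].
Qed.

Definition stable_fmap (X Y : stable A) (s : hom X Y) :
  @hom (stable B) (F X) (F Y) := st (fmap F (stable_repr s)).

Lemma stable_fmapE (X Y : A) (f : hom X Y) : stable_fmap (st f) = st (fmap F f).
Proof.
apply/stable_classP; rewrite -fmapN -fmap_add.
exact: frobenius_functor_null (stable_repr_class f).
Qed.

Lemma stable_fmap_id (X : stable A) : stable_fmap (idm X) = @idm (stable B) (F X).
Proof. by rewrite -st_id stable_fmapE fmap_id. Qed.

Lemma stable_fmap_comp (X Y Z : stable A) (g : hom Y Z) (f : hom X Y) :
  stable_fmap (g \oc f) = stable_fmap g \oc stable_fmap f.
Proof.
have [f0 ->] := st_surj f; have [g0 ->] := st_surj g.
by rewrite stM !stable_fmapE stM fmap_comp.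
Qed.

Lemma stable_fmap_add (X Y : stable A) (f g : hom X Y) :
  stable_fmap (f + g) = stable_fmap f + stable_fmap g.
Proof.
have [f0 ->] := st_surj f; have [g0 ->] := st_surj g.
by rewrite -stD !stable_fmapE -stD fmap_add.
Qed.

Definition stable_functor : functor (stable A) (stable B) :=
  Functor stable_fmap_id stable_fmap_comp stable_fmap_add.

Lemma st_iso (X Y : B) (f : hom X Y) : is_iso f -> is_iso (st f).
Proof. by move=> [g [e1 e2]]; exists (st g); rewrite !stM e1 e2. Qed.

Lemma image_hull (X : A) : confl (fmap F (hi X)) (fmap F (hp X)).
Proof. by apply: (proj1 hF); exact: hi_hp_confl. Qed.

Lemma image_hull_inj (X : A) : inj_obj (@confl B) (F (hI X)).
Proof. by have [] := proj2 hF _ (inj_projinj (@hI_inj A X)). Qed.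

(** The image under [F] of the chosen hull of [X] is a hull of [F X], in general not the chosen one;
    the map compares the two cosyzygies. *)
Lemma shift_compare_exists (X : A) : exists e : hom (F (hS X)) (hS (F X)),
  exists m, m \oc fmap F (hi X) = hi (F X) /\ e \oc fmap F (hp X) = hp (F X) \oc m.
Proof.
have [m [e [em ee]]] :=
  confl_extend (idm (F X)) (image_hull X) (hi_hp_confl (F X)) (@hI_inj B (F X)).
by exists e, m; rewrite em mcompm1.
Qed.

Definition shift_compare (X : A) : hom (F (hS X)) (hS (F X)) :=
  projT1 (cid (shift_compare_exists X)).

Lemma shift_compareP (X : A) : exists m, m \oc fmap F (hi X) = hi (F X) /\
  shift_compare X \oc fmap F (hp X) = hp (F X) \oc m.
Proof. exact: projT2 (cid (shift_compare_exists X)). Qed.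

Lemma shift_compare_iso (X : A) : is_iso (st (shift_compare X)).
Proof.
have [m [em ee]] := shift_compareP X.
exact: (st_confl_iso (image_hull X) (hi_hp_confl _) (@image_hull_inj X)
  (@hI_inj _ _) em ee).
Qed.

(** Both composites are induced by maps [F (hI X) -> hI (F Y)] that agree on [F X]. *)
Lemma shift_compare_nat (X Y : stable A) (s : hom X Y) :
  st (shift_compare Y) \oc fmap stable_functor (fmap (stable_shift A) s)
  = fmap (stable_shift B) (fmap stable_functor s) \oc st (shift_compare X).
Proof.
have [f ->] := st_surj s.
have [h hh] := shift_lift_exists f.
have [h' hh'] := shift_lift_exists (fmap F f).
rewrite (shift_st hh).
have e1 : fmap stable_functor (st h) = st (fmap F h) := stable_fmapE h.
have e2 : fmap stable_functor (st f) = st (fmap F f) := stable_fmapE f.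
rewrite e1 e2 (shift_st hh') [LHS]stM [RHS]stM.
have [m [em ee]] := shift_compareP X.
have [m' [em' ee']] := shift_compareP Y.
case: hh => g [eg eh]; case: hh' => g' [eg' eh'].
apply: (st_confl_uniq (r := hp (F Y)) (m := m' \oc fmap F g) (m' := g' \oc m)
  (image_hull X) (@hI_inj B (F Y))).
- by rewrite -mcompA -fmap_comp eh fmap_comp mcompA ee' mcompA.
- by rewrite -mcompA ee (mcompA h') eh' mcompA.
- by rewrite -!mcompA em eg' -fmap_comp eg fmap_comp mcompA em'.
Qed.

Lemma stable_functor_dist (t : triangle (stable_shift A)) :
  @dist (stable_triang A) t ->
  @dist (stable_triang B) (@triangle_image _ _ (stable_shift A) (stable_shift B)
    stable_functor (fun X => st (shift_compare X)) t).
Proof.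
move=> /dist_standard[X [Y [W [f [g [u [h [hpo hg hu ht]]]]]]]].
have himg := @triangle_image_iso _ _ (stable_shift A) (stable_shift B) stable_functor
  (fun X => st (shift_compare X)) shift_compare_nat _ _ ht.
apply: (dist_iso himg).
have hgh := pushout_confl (frob_exact (frobP A)) (hi_hp_confl X) hpo hg hu.
have [m [em ee]] := shift_compareP X.
(* Exactness of [F] concerns conflations only; the push-out is recovered from the images of the two
   conflations ending in [hS X]. *)
have hpo' : is_pushout (fmap F f) (fmap F (hi X)) (fmap F g) (fmap F u).
  apply: (confl_pushout (frob_exact (frobP B)) (image_hull X) (proj1 hF _ _ _ _ _ hgh)).
    by rewrite -!fmap_comp (proj1 hpo).
  by rewrite -fmap_comp hu.
have : st_dist (fmap F f) (fmap F g) (shift_compare X \oc fmap F h).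
  apply: (dist_pushout (image_hull X) (@image_hull_inj X) hpo' _ _ em ee).
    by rewrite -fmap_comp hg fmap0.
  by rewrite -fmap_comp hu.
by rewrite /st_dist -!stM -!stable_fmapE.
Qed.

End StableFunctor.

Lemma stable_nat_iso_id (A B : frobCat) (F : functor A B) (G : functor B A)
    (hF : frobenius_functor F) (hG : frobenius_functor G) :
  nat_isomorphic (functor_comp G F) (functor_id A) ->
  nat_isomorphic (functor_comp (stable_functor hG) (stable_functor hF))
    (functor_id (stable A)).
Proof.
move=> [eta [h1 h2]]; exists (fun X => st (eta X)); split.
  by move=> X; exact: st_iso (h1 X).
move=> X Y s; have [f ->] := st_surj s.
change (st (eta Y) \oc stable_fmap G (stable_fmap F (st f)) = st f \oc st (eta X)).
by rewrite (stable_fmapE hF) (stable_fmapE hG) [LHS]stM [RHS]stM h2.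
Qed.

Lemma frobenius_triangle_equivalent (A B : frobCat) :
  frobenius_equivalent A B ->
  triangle_equivalent (stable_triang A) (stable_triang B).
Proof.
move=> [F [G [[h1 h2] hF hG]]]; exists (stable_functor hF); split.
  by exists (stable_functor hG); split; exact: stable_nat_iso_id.
exists (fun X => st (shift_compare hF X)); split.
  split; first by move=> X; exact: (shift_compare_iso hF).
  exact: shift_compare_nat.
by move=> X Y Z f g h; exact: (@stable_functor_dist _ _ _ hF (Tri f g h)).
Qed.

(** * Kernels and cokernels *)

Section KernelCokernel.
Context (F : frobCat).
Let hF := frob_exact (frobP F).
Local Notation Me := (MorE F).
Local Notation Mm := (MorM F).

Definition ker_obj (a : Me) : F := projT1 (cid (arrowP a)).
Definition ker_mor (a : Me) : hom (ker_obj a) (asrc a) :=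
  projT1 (cid (projT2 (cid (arrowP a)))).
Lemma ker_confl (a : Me) : confl (ker_mor a) (amap a).
Proof. exact: projT2 (cid (projT2 (cid (arrowP a)))). Qed.

Definition coker_obj (b : Mm) : F := projT1 (cid (arrowP b)).
Definition coker_mor (b : Mm) : hom (atgt b) (coker_obj b) :=
  projT1 (cid (projT2 (cid (arrowP b)))).
Lemma coker_confl (b : Mm) : confl (amap b) (coker_mor b).
Proof. exact: projT2 (cid (projT2 (cid (arrowP b)))). Qed.

Lemma ker_map_exists (a b : Me) (u : hom a b) :
  exists k, arrow_src u \oc ker_mor a = ker_mor b \oc k.
Proof.
have : amap b \oc (arrow_src u \oc ker_mor a) = 0.
  by rewrite mcompA -arrow_square -mcompA (confl0 hF (ker_confl a)) mcompm0.
by case/(proj2 (confl_kernel hF (ker_confl b))) => k [ek _]; exists k.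
Qed.

Lemma coker_map_exists (a b : Mm) (u : hom a b) :
  exists k, k \oc coker_mor a = coker_mor b \oc arrow_tgt u.
Proof.
have : coker_mor b \oc arrow_tgt u \oc amap a = 0.
  by rewrite -mcompA arrow_square mcompA (confl0 hF (coker_confl b)) mcomp0m.
by case/(proj2 (confl_cokernel hF (coker_confl a))) => k [ek _]; exists k.
Qed.

Definition ker_arrow (a : Me) : Mm := Arrow (confl_mono (ker_confl a)).
Definition coker_arrow (b : Mm) : Me := Arrow (confl_epi (coker_confl b)).

Definition ker_map (a b : Me) (u : hom a b) : hom (ker_arrow a) (ker_arrow b) :=
  @arrow_mk _ _ (ker_arrow a) (ker_arrow b) _ (arrow_src u)
    (projT2 (cid (ker_map_exists u))).

Definition coker_map (a b : Mm) (u : hom a b) :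
    hom (coker_arrow a) (coker_arrow b) :=
  @arrow_mk _ _ (coker_arrow a) (coker_arrow b) (arrow_tgt u) _
    (projT2 (cid (coker_map_exists u))).

(** The source component is determined because [amap b] is monic. As [ker_map] takes the old source
    component as its target component, its functor laws then hold by conversion. *)
Lemma hom_MorM_ext (a b : Mm) (u v : hom a b) :
  arrow_tgt u = arrow_tgt v -> u = v.
Proof.
move=> e; apply: arrow_ext => //; apply: (confl_monic hF (coker_confl b)).
by rewrite -!arrow_square e.
Qed.

Lemma hom_MorE_ext (a b : Me) (u v : hom a b) :
  arrow_src u = arrow_src v -> u = v.
Proof.
move=> e; apply: arrow_ext => //; apply: (confl_epic hF (ker_confl a)).
by rewrite !arrow_square e.
Qed.

Lemma ker_map_id (a : Me) : ker_map (idm a) = idm (ker_arrow a).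
Proof. exact: hom_MorM_ext. Qed.

Lemma ker_map_comp (a b c : Me) (v : hom b c) (u : hom a b) :
  ker_map (v \oc u) = ker_map v \oc ker_map u.
Proof. exact: hom_MorM_ext. Qed.

Lemma ker_map_add (a b : Me) (u v : hom a b) :
  ker_map (u + v) = ker_map u + ker_map v.
Proof. exact: hom_MorM_ext. Qed.

Lemma coker_map_id (a : Mm) : coker_map (idm a) = idm (coker_arrow a).
Proof. exact: hom_MorE_ext. Qed.

Lemma coker_map_comp (a b c : Mm) (v : hom b c) (u : hom a b) :
  coker_map (v \oc u) = coker_map v \oc coker_map u.
Proof. exact: hom_MorE_ext. Qed.

Lemma coker_map_add (a b : Mm) (u v : hom a b) :
  coker_map (u + v) = coker_map u + coker_map v.
Proof. exact: hom_MorE_ext. Qed.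

Definition ker_functor : functor Me Mm :=
  Functor ker_map_id ker_map_comp ker_map_add.

Definition coker_functor : functor Mm Me :=
  Functor coker_map_id coker_map_comp coker_map_add.

(** The isomorphism is chosen to be the identity on sources, which reduces its naturality to unit
    laws through [hom_MorE_ext]. *)
Lemma coker_ker_iso (a : Me) : exists u : hom (coker_arrow (ker_arrow a)) a,
  is_iso u /\ arrow_src u = idm (asrc a).
Proof.
have [c hc ec] := is_cokernel_uniq (confl_cokernel hF (ker_confl a))
  (confl_cokernel hF (coker_confl (ker_arrow a))).
have [|u u1 u2] := @arrow_mkK _ _ (coker_arrow (ker_arrow a)) a (idm _) c.
  by rewrite mcompm1.
by exists u; split=> //; apply/arrow_iso; rewrite u1 u2; split=> //; exact: is_iso_id.
Qed.

Lemma ker_coker_iso (b : Mm) : exists u : hom (ker_arrow (coker_arrow b)) b,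
  is_iso u /\ arrow_tgt u = idm (atgt b).
Proof.
have [c hc ec] := is_kernel_uniq (confl_kernel hF (ker_confl (coker_arrow b)))
  (confl_kernel hF (coker_confl b)).
have [|u u1 u2] := @arrow_mkK _ _ (ker_arrow (coker_arrow b)) b c (idm _).
  by rewrite mcomp1m.
by exists u; split=> //; apply/arrow_iso; rewrite u1 u2; split=> //; exact: is_iso_id.
Qed.

Lemma ker_coker_quasi_inverse : quasi_inverse ker_functor coker_functor.
Proof.
split.
- exists (fun a => projT1 (cid (coker_ker_iso a))); split.
    by move=> a; case: (projT2 (cid (coker_ker_iso a))).
  move=> a b u; apply: hom_MorE_ext; rewrite !arrow_srcM.
  rewrite (proj2 (projT2 (cid (coker_ker_iso a)))).
  rewrite (proj2 (projT2 (cid (coker_ker_iso b)))).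
  by rewrite mcompm1 mcomp1m.
- exists (fun a => projT1 (cid (ker_coker_iso a))); split.
    by move=> a; case: (projT2 (cid (ker_coker_iso a))).
  move=> a b u; apply: hom_MorM_ext; rewrite !arrow_tgtM.
  rewrite (proj2 (projT2 (cid (ker_coker_iso a)))).
  rewrite (proj2 (projT2 (cid (ker_coker_iso b)))).
  by rewrite mcompm1 mcomp1m.
Qed.

Lemma ker_functor_exact (a b c : Me) (u : hom a b) (v : hom b c) :
  MorE_confl u v -> MorM_confl (ker_map u) (ker_map v).
Proof.
move=> [h1 h2]; apply/MorM_conflP; split=> //.
have [_ H] := three_by_three_epi hF h1 h2 (esym (arrow_square u))
  (esym (arrow_square v)) (ker_confl a) (ker_confl c).
apply: (H _ _ _ _ (confl_kernel hF (ker_confl b))).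
- exact: (arrow_square (ker_map u)).
- exact: esym (arrow_square (ker_map v)).
Qed.

Lemma coker_functor_exact (a b c : Mm) (u : hom a b) (v : hom b c) :
  MorM_confl u v -> MorE_confl (coker_map u) (coker_map v).
Proof.
move=> /MorM_conflP[h1 h2]; split=> //.
have [_ H] := three_by_three_mono hF h1 h2 (esym (arrow_square u))
  (esym (arrow_square v)) (coker_confl a) (coker_confl c).
apply: (H _ _ _ _ (confl_cokernel hF (coker_confl b))).
- exact: (arrow_square (coker_map u)).
- exact: (arrow_square (coker_map v)).
Qed.

(** An admissible epimorphism onto a projective splits, so its kernel is a retract of its source. *)
Lemma ker_functor_projinj (a : Me) : Proj_MorE a -> Proj_MorM (ker_arrow a).
Proof.
move=> [h1 h2]; split=> //.
have [s es] := proj1 h2 _ _ _ (idm _) (arrowP a).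
have : amap a \oc (idm _ - s \oc amap a) = 0.
  by rewrite mcompBr mcompm1 mcompA es mcomp1m subrr.
case/(proj2 (confl_kernel hF (ker_confl a))) => r [er _].
apply: (projinj_retract (s := ker_mor a) (r := r)) h1.
apply: (confl_monic hF (ker_confl a)).
rewrite mcompA er mcompBl -mcompA (confl0 hF (ker_confl a)).
by rewrite mcompm0 subr0 mcomp1m mcompm1.
Qed.

Lemma coker_functor_projinj (b : Mm) : Proj_MorM b -> Proj_MorE (coker_arrow b).
Proof.
move=> [h1 h2]; split=> //.
have [s es] := proj2 h1 _ _ _ (idm _) (arrowP b).
have : (idm _ - amap b \oc s) \oc amap b = 0.
  by rewrite mcompBl mcomp1m -mcompA es mcompm1 subrr.
case/(proj2 (confl_cokernel hF (coker_confl b))) => r [er _].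
apply: (projinj_retract (s := r) (r := coker_mor b)) h2.
apply: (confl_epic hF (coker_confl b)).
rewrite -mcompA er mcompBr mcompA (confl0 hF (coker_confl b)).
by rewrite mcomp0m subr0 mcomp1m mcompm1.
Qed.

End KernelCokernel.

Theorem proposition6p8 (F : frobCat) :
  exists (HE : is_frobenius (@MorE_confl F)) (HM : is_frobenius (@MorM_confl F)),
    let ME := FrobCat HE in
    let MM := FrobCat HM in
    [/\ (forall a : MorE F, projinj (@MorE_confl F) a <-> Proj_MorE a)
          /\ is_triangulated (stable_triang ME),
        (forall a : MorM F, projinj (@MorM_confl F) a <-> Proj_MorM a)
          /\ is_triangulated (stable_triang MM)
      & frobenius_equivalent ME MM
          /\ triangle_equivalent (stable_triang ME) (stable_triang MM)].
Proof.
have [HE PE] := MorE_frobenius F; have [HM PM] := MorM_frobenius F.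
exists HE, HM => ME MM.
have eqv : frobenius_equivalent ME MM.
  exists (ker_functor F), (coker_functor F); split.
  - exact: ker_coker_quasi_inverse.
  - split; first exact: ker_functor_exact.
    (* [PE] and [PM] translate projective-injectivity into a condition on the two components, which
       is what the kernel construction controls. *)
    by move=> a /PE/ker_functor_projinj/PM.
  - split; first exact: coker_functor_exact.
    by move=> a /PM/coker_functor_projinj/PE.
split; [split | split | split] => //; try exact: stable_triangulated.
exact: frobenius_triangle_equivalent.
Qed.
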